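(* (Universality of arbitrary polynomial convergence via analyticity in the almost periodic case.) Let $\eta\ge2$ be an integer, let $\mu>1$, $\gamma>0$, let $\tilde\Delta_\infty$ be an approximation function and let $f\in\mathcal B_{\tilde\Delta_\infty}$. Assume that $\rho\in\mathbb T^\infty$ satisfies the infinite-dimensional Diophantine condition with parameters $\gamma,\mu$, and that $f$ is analytic in some neighbourhood of $\mathbb T^\infty$ in $\mathbb C^{\mathbb N}$. Then for every integer $m\ge2$ and every $\mathcal C_0^m([0,1])$ weighting function $w$ there is a constant $C_3>0$, depending only on $f,\tilde\Delta_\infty,\eta,\mu,w,\gamma,m$, such that for all $\theta\in\mathbb T^\infty$ $$\left\|\mathrm{WB}_N(f)(\theta)-\int_{\mathbb T^\infty}f(\hat\theta)\,d\hat\theta\right\|_{\mathcal B}\le\frac{C_3}{N^m}\quad\text{for all integers } N\ge2,$$ and $$\left\|\frac1T\int_0^T w(t/T)\,f(\rho t+\theta)\,dt-\int_{\mathbb T^\infty}f(\hat\theta)\,d\hat\theta\right\|_{\mathcal B}\le\frac{C_3}{T^m}\quad\text{for all real } T\ge1.$$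
   Context: An approximation function is a continuous, strictly increasing function $\Delta:[1,+\infty)\to[1,+\infty)$ with $\Delta(+\infty)=+\infty$. $\mathbb N=\{0,1,2,\dots\}$, $\mathbb T^\infty=\mathbb T^{\mathbb N}$ with the product (normalized Lebesgue) probability measure; the set of rotation vectors $\rho$ is identified with the cube $[1,2]^{\mathbb N}$. For a fixed integer $\eta\ge2$, $$\mathbb Z_*^\infty=\Big\{k\in\mathbb Z^{\mathbb N}:\ |k|_\eta:=\sum_{j\in\mathbb N}\langle j\rangle^\eta|k_j|<+\infty\Big\},\qquad \langle j\rangle=\max\{1,|j|\},$$ so each such $k$ has finite support. The vector $\rho$ satisfies the infinite-dimensional Diophantine condition with parameters $\gamma>0$, $\mu>1$ if $$|k\cdot\rho-n|>\frac{\gamma}{\prod_{j\in\mathbb N}\left(1+|k_j|^\mu\langle j\rangle^\mu\right)}\qquad\text{for all } 0\ne k\in\mathbb Z_*^\infty,\ n\in\mathbb Z.$$ $(\mathcal B,\|\cdot\|_{\mathcal B})$ is a Banach (function) space, possibly infinite-dimensional, over complex scalars. For an approximation function $\tilde\Delta_\infty$, $\mathcal B_{\tilde\Delta_\infty}$ is the set of $f:\mathbb T^\infty\to\mathcal B$ such that $f(\theta)=\sum_{k\in\mathbb Z_*^\infty}\hat f_k e^{2\pi i k\cdot\theta}$ for every $\theta$ (equality in the norm of $\mathcal B$), where $\hat f_k=\int_{\mathbb T^\infty}f(\hat\theta)e^{-2\pi i k\cdot\hat\theta}\,d\hat\theta$, and $\sup_{0\ne k\in\mathbb Z_*^\infty}\tilde\Delta_\infty(|k|_\eta)\,\|\hat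 f_k\|_{\mathcal B}<+\infty$. Analyticity of $f$ in a neighbourhood of $\mathbb T^\infty$ in $\mathbb C^{\mathbb N}$ is understood, in this spatial structure, as exponential decay of the Fourier coefficients with respect to $|\cdot|_\eta$: there is $\sigma>0$ with $\sup_{0\ne k\in\mathbb Z_*^\infty}e^{\sigma|k|_\eta}\|\hat f_k\|_{\mathcal B}<+\infty$. A $\mathcal C_0^m([0,1])$ weighting function is $w\in C^\infty([0,1])$ with $w^{(k)}(0)=w^{(k)}(1)=0$ for all $0\le k\le m$, $w(x)>0$ for $x\in(0,1)$, and $\int_0^1 w(s)\,ds=1$. With $T_\rho(\theta)=\theta+\rho \bmod 1$ in each coordinate, the weighted Birkhoff average is $$\mathrm{WB}_N(f)(\theta)=\frac1{A_N}\sum_{n=0}^{N-1}w\!\left(\frac nN\right)f(T_\rho^n(\theta)),\qquad A_N=\sum_{n=0}^{N-1}w\!\left(\frac nN\right).$$ *)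

(* Defs.v *)
From HB Require Import structures.
From mathcomp Require Import all_boot all_order all_algebra.
From mathcomp Require Import finmap.
From mathcomp Require Import complex.
From mathcomp Require Import all_classical all_reals all_analysis.
From mathcomp Require Import summability.

Set Implicit Arguments.
Unset Strict Implicit.
Unset Printing Implicit Defensive.

Import Order.TTheory GRing.Theory Num.Theory.
Import numFieldNormedType.Exports.

Local Open Scope classical_set_scope.
Local Open Scope ring_scope.
Local Open Scope complex_scope.

(* The norm of a normed space over R[i] takes its (nonnegative real) values
   in R[i]; [bnorm] is the same norm with values in R. *)
Definition bnorm (R : realType) (B : completeNormedModType R[i]) (x : B) : R :=
  complex.Re `|x|.

(** Bochner integral *)

Section bochner.
Context d (T : measurableType d) (R : realType).
Context (B : completeNormedModType R[i]).
Variables (mu : {measure set T -> \bar R}) (D : set T).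

Definition bsimple (s : T -> B) : Prop :=
  [/\ finite_set (range s),
      forall v, measurable (s @^-1` [set v]) &
      forall v, v != 0 -> (mu (D `&` s @^-1` [set v]) < +oo)%E].

Definition bsimple_integral (s : T -> B) : B :=
  \sum_(v \in range s) (fine (mu (D `&` s @^-1` [set v])))%:C *: v.

Definition is_bochner_integral (f : T -> B) (v : B) : Prop :=
  exists s : nat -> T -> B,
    [/\ forall n, bsimple (s n),
        {ae mu, forall x, D x -> (fun n => s n x) @ \oo --> f x},
        (fun n => \int[mu]_(x in D) (bnorm (f x - s n x))%:E)%E @ \oo --> 0%E &
        (fun n => bsimple_integral (s n)) @ \oo --> v].

Definition bochner_integrable (f : T -> B) : Prop :=
  exists v, is_bochner_integral f v.

(* equal to 0 when f is not Bochner integrable *)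
Definition bochner_integral (f : T -> B) : B :=
  xget 0 [set v | is_bochner_integral f v].

End bochner.

(** The torus T^oo *)

(* The circle R/Z, represented by its fundamental domain [0, 1[. *)
Definition circle (R : realType) : Type := {x : R | 0 <= x < 1}.

Section circle.
Variable R : realType.

HB.instance Definition _ := Choice.copy (circle R) {x : R | 0 <= x < 1}.

Fact mod1_subproof (x : R) : 0 <= x - (Num.floor x)%:~R < 1.
Proof. by rewrite subr_ge0 floor_le_tmp ltrBlDl -intrD1 floorD1_gt. Qed.

Definition mod1 (x : R) : circle R :=
  exist (fun y : R => is_true (0 <= y < 1)) _ (mod1_subproof x).

HB.instance Definition _ := isPointed.Build (circle R) (mod1 0).

(* Generators of the product sigma-algebra on the countable power of the
   circle, the circle carrying the Borel sets of [0, 1[. *)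
Definition cylinders : set (set (nat -> circle R)) :=
  [set A | exists (j : nat) (U : set R),
     measurable U /\ A = [set theta | U (sval (theta j))]].

Definition torus : Type := g_sigma_algebraType cylinders.

HB.instance Definition _ := Measurable.on torus.

(* This determines vol uniquely: the countable product of the Lebesgue
   probability measures on the circle. *)
Definition is_product_measure (vol : set torus -> \bar R) : Prop :=
  forall (n : nat) (U : nat -> set R), (forall j, measurable (U j)) ->
    vol [set theta : torus | forall j, (j < n)%N -> U j (sval (theta j))] =
    (\prod_(j < n) lebesgue_measure (U j `&` `[0%R, 1%R[))%E.

Definition torus_proj (x : nat -> R) : torus := fun j => mod1 (x j).

Definition rotation (rho : nat -> R) (theta : torus) : torus :=
  torus_proj (fun j => sval (theta j) + rho j).

Definition flow (rho : nat -> R) (t : R) (theta : torus) : torus :=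
  torus_proj (fun j => rho j * t + sval (theta j)).

End circle.

(** The frequency lattice *)

Section lattice.
Variable R : realType.

Definition jbr (j : nat) : nat := maxn 1 j.

Definition eta_norm_ereal (eta : nat) (k : nat -> int) : \bar R :=
  (\sum_(0 <= j <oo) ((jbr j ^ eta)%N%:R * `|(k j)%:~R|)%:E)%E.

Definition Zstar (eta : nat) : set (nat -> int) :=
  [set k | (eta_norm_ereal eta k < +oo)%E].

Definition eta_norm (eta : nat) (k : nat -> int) : R :=
  fine (eta_norm_ereal eta k).

(* Elements of Zstar have finite support, so that this is a finite sum; in
   general [\sum_(j \in A)] ranges over the support of its summand, and is 0
   when that support is infinite. *)
Definition kdot (k : nat -> int) (x : nat -> R) : R :=
  \sum_(j \in [set: nat]) (k j)%:~R * x j.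

Definition dioph_prod (mu : R) (k : nat -> int) : R :=
  \big[*%R/1]_(j \in [set: nat])
     (1 + `|(k j)%:~R| `^ mu * (jbr j)%:R `^ mu).

Definition diophantine (eta : nat) (gamma mu : R) (rho : nat -> R) : Prop :=
  forall (k : nat -> int) (n : int), Zstar eta k -> k <> (fun=> 0) ->
    gamma / dioph_prod mu k < `|kdot k rho - n%:~R|.

(* exp (2 i pi x) *)
Definition cis (x : R) : R[i] := cos (2 * pi * x) +i* sin (2 * pi * x).

Definition character (k : nat -> int) (theta : torus R) : R[i] :=
  cis (kdot k (fun j => sval (theta j))).

End lattice.

(** The function space and analyticity *)

Definition approximation_function (R : realType) (Delta : R -> R) : Prop :=
  [/\ {within `[1, +oo[, continuous Delta},
      {in `[1, +oo[ &, {homo Delta : x y / x < y}},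
      forall x, 1 <= x -> 1 <= Delta x &
      Delta x @[x --> +oo] --> +oo].

Section function_space.
Context (R : realType) (B : completeNormedModType R[i]).
Variable vol : probability (torus R) R.
Variable eta : nat.

Definition fourier_coeff (f : torus R -> B) (k : nat -> int) : B :=
  bochner_integral vol setT
    (fun theta => character (fun j => - k j) theta *: f theta).

(* The series over the (unordered) set Zstar is the limit of its finite
   partial sums along the directed set of finite subsets. *)
Definition in_BDelta (Delta : R -> R) (f : torus R -> B) : Prop :=
  [/\ bochner_integrable vol setT f,
      forall theta,
        partial_sum (fun k : Zstar R eta =>
          character (val k) theta *: fourier_coeff f (val k))
        @ totally --> f theta &
      exists M : R, forall k, Zstar R eta k -> k <> (fun=> 0) ->
        Delta (eta_norm R eta k) * bnorm (fourier_coeff f k) <= M].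

Definition analytic_torus (f : torus R -> B) : Prop :=
  exists2 sigma : R, 0 < sigma &
    exists M : R, forall k, Zstar R eta k -> k <> (fun=> 0) ->
      expR (sigma * eta_norm R eta k) * bnorm (fourier_coeff f k) <= M.

End function_space.

(** Weighting functions and weighted averages *)

Section weight.
Variable R : realType.

(* Differentiation of functions on [0, 1], one-sided at the end points; the
   values of a weight outside [0, 1] are irrelevant. *)
Definition slope01 (g : R -> R) (x y : R) : R := (g y - g x) / (y - x).

Definition deriv01 (g : R -> R) (x : R) : R :=
  lim (slope01 g x @ within `[0, 1] x^').

Definition smooth01 (w : R -> R) : Prop :=
  forall (k : nat) (x : R), x \in `[0, 1] ->
    cvg (slope01 (iter k deriv01 w) x @ within `[0, 1] x^').

Definition weighting_function (m : nat) (w : R -> R) : Prop :=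
  [/\ smooth01 w,
      forall k, (k <= m)%N -> iter k deriv01 w 0 = 0 /\ iter k deriv01 w 1 = 0,
      forall x, 0 < x < 1 -> 0 < w x &
      (\int[lebesgue_measure]_(s in `[0%R, 1%R]) (w s)%:E = 1)%E].

Definition weight_total (w : R -> R) (N : nat) : R :=
  \sum_(n < N) w (n%:R / N%:R).

Context (B : completeNormedModType R[i]).

Definition WB (w : R -> R) (rho : nat -> R) (f : torus R -> B) (N : nat)
    (theta : torus R) : B :=
  (weight_total w N)^-1%:C *:
    \sum_(n < N) (w (n%:R / N%:R))%:C *: f (iter n (rotation rho) theta).

Definition flow_integrand (w : R -> R) (rho : nat -> R) (f : torus R -> B)
    (T : R) (theta : torus R) (t : R) : B :=
  (w (t / T))%:C *: f (flow rho t theta).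

Definition WB_flow (w : R -> R) (rho : nat -> R) (f : torus R -> B) (T : R)
    (theta : torus R) : B :=
  T^-1%:C *: bochner_integral (@lebesgue_measure R) `[0, T]
               (flow_integrand w rho f T theta).

End weight.

(* Main.v *)
Require Import Defs.
From mathcomp Require Import all_boot all_order all_algebra.
From mathcomp Require Import finmap.
From mathcomp Require Import complex.
From mathcomp Require Import all_classical all_reals all_analysis.
From mathcomp Require Import measurable_realfun.
From mathcomp Require Import summability.
From mathcomp Require Import ring lra zify.

(** Both averages are finite or limiting linear combinations sum_i c_i f(theta_i)
    of values of f along an orbit. Inserting the Fourier series of f
    ([fourier_combination]), such a combination differs from (sum_i c_i) times
    the mean of f by a series over the nonzero frequencies k, whose k-th term is
    the Fourier coefficient of f at k times sum_i c_i chi_k(theta_i). Along the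
    rotation by rho, chi_k is a geometric sequence of ratio z = cis(k.rho), so
    everything rests on exponential sums of samples of the weight.

    Extended by zero, the weight is C^m on the line. Summing by parts m times
    gives |1 - z|^m |sum_n w(n/N) z^n| <= M N / N^m ([weight_exp_sum]), while
    the normalisation A_N is at least c N ([weight_total_ge]). The Diophantine
    condition bounds |1 - z| below by gamma over the Diophantine product P(k)
    ([chord_ge]). Hence the k-th term is at most a constant times P(k)^m / N^m
    times the norm of the Fourier coefficient. It remains that the sum over k of
    P(k)^m exp(- sigma |k|_eta) is finite ([lattice_sum]): both factors are
    products over the coordinates, and the one-dimensional sums are 1 + O(j^-2),
    so that their infinite product converges.

    The continuous average needs no separate oscillatory estimate. The integrand
    is Lipschitz in t ([flow_integrand_lipschitz], again a linear combination of
    two values of f), so it is Bochner integrable and every Bochner integral of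
    it is the limit of Riemann sums ([lipschitz_riemann]). The Riemann sum with n
    nodes is a weighted sum along the rotation by T rho / n, to which the same
    exponential sum applies as long as the angle T k.rho / n is at most 1/2: the
    chord is then comparable with the angle and the factors n cancel, leaving
    (T |k.rho|)^-m. For the remaining frequencies P(k) is at least of the order
    of n / T, hence of T once n >= T^2, and the trivial bound suffices
    ([flow_node_sum]). The bound is uniform in n, so it passes to the limit. *)

Set Implicit Arguments.
Unset Strict Implicit.
Unset Printing Implicit Defensive.

Import Order.TTheory GRing.Theory Num.Theory.
Import numFieldNormedType.Exports.

Local Open Scope classical_set_scope.
Local Open Scope ring_scope.

(** * The modulus on R[i] and the real-valued norm *)

Lemma norm_normc (R : realType) (z : R[i]) : `|z| = (Normc.normc z)%:C%C.
Proof. by rewrite normc_def; case: z. Qed.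

Lemma normc_ge0 (R : realType) (z : R[i]) : 0 <= Normc.normc z.
Proof. by case: z => a b; exact: sqrtr_ge0. Qed.

Lemma normc_real (R : realType) (x : R) : Normc.normc x%:C%C = `|x|.
Proof. by rewrite /= expr0n addr0 sqrtr_sqr. Qed.

Lemma normcD (R : realType) (x y : R[i]) :
  Normc.normc (x + y) <= Normc.normc x + Normc.normc y.
Proof. by rewrite -lecR rmorphD/= -!norm_normc ler_normD. Qed.

Lemma normcX (R : realType) (z : R[i]) n :
  Normc.normc (z ^+ n) = Normc.normc z ^+ n.
Proof.
elim: n => [|n IH]; first by rewrite !expr0 Normc.normc1.
by rewrite !exprS Normc.normcM IH.
Qed.

Lemma normc_sum (R : realType) (I : Type) (r : seq I) (P : pred I)
    (F : I -> R[i]) :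
  Normc.normc (\sum_(i <- r | P i) F i)
    <= \sum_(i <- r | P i) Normc.normc (F i).
Proof.
elim/big_ind2 : _ => //; first by rewrite Normc.normc0.
by move=> x1 x2 y1 y2 h1 h2; apply: le_trans (normcD _ _) _; exact: lerD.
Qed.

Lemma normc_le_ReIm (R : realType) (a b : R) :
  Normc.normc (a +i* b)%C <= `|a| + `|b|.
Proof.
rewrite -[leRHS]ger0_norm ?addr_ge0// -sqrtr_sqr ler_sqrt ?sqr_ge0//.
rewrite sqrrD !real_normK ?num_real//.
rewrite addrAC lerDl mulrn_wge0// mulr_ge0//.
Qed.

Section bnorm.
Context (R : realType) (B : completeNormedModType R[i]).
Implicit Types x y : B.

Lemma norm_bnorm x : `|x| = (bnorm x)%:C%C.
Proof. by rewrite /bnorm RRe_real// ger0_real. Qed.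

Lemma bnorm_ge0 x : 0 <= bnorm x.
Proof. by rewrite -lecR -norm_bnorm; exact: normr_ge0. Qed.

Lemma bnorm0 : bnorm (0 : B) = 0.
Proof. by rewrite /bnorm normr0. Qed.

Lemma bnormD x y : bnorm (x + y) <= bnorm x + bnorm y.
Proof. by rewrite -lecR rmorphD/= -!norm_bnorm ler_normD. Qed.

Lemma bnormB x y : bnorm (x - y) = bnorm (y - x).
Proof. by rewrite /bnorm distrC. Qed.

Lemma bnorm_triangle x y (z : B) : bnorm (x - z) <= bnorm (x - y) + bnorm (y - z).
Proof. by apply: le_trans (bnormD _ _); rewrite addrA subrK. Qed.

Lemma bnorm_dist x y : `|bnorm x - bnorm y| <= bnorm (x - y).
Proof.
have h (u v : B) : bnorm u - bnorm v <= bnorm (u - v).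
  by rewrite lerBlDr; apply: le_trans (bnormD _ _); rewrite subrK.
by rewrite ler_norml h andbT lerNl opprB bnormB h.
Qed.

Lemma bnormZ (c : R[i]) x : bnorm (c *: x) = Normc.normc c * bnorm x.
Proof. by rewrite /bnorm normrZ norm_normc norm_bnorm -rmorphM. Qed.

Lemma bnorm_sum (I : Type) (r : seq I) (P : pred I) (F : I -> B) :
  bnorm (\sum_(i <- r | P i) F i) <= \sum_(i <- r | P i) bnorm (F i).
Proof.
elim/big_ind2 : _ => //; first by rewrite bnorm0.
by move=> x1 x2 y1 y2 h1 h2; apply: le_trans (bnormD _ _) _; exact: lerD.
Qed.

(** A positive element of R[i] is real, so balls of real radius generate the
    topology of B. *)
Lemma cvg_bnorm (T : Type) (F : set_system T) (FF : Filter F) (u : T -> B)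
    (l : B) :
  u @ F --> l <->
  forall e : R, 0 < e -> \forall t \near F, bnorm (l - u t) < e.
Proof.
split=> [/cvgrPdist_lt h e e0|h].
  have /h : 0 < e%:C%C by rewrite ltcR.
  by apply: filterS => t; rewrite norm_bnorm ltcR.
apply/cvgrPdist_lt => e; rewrite ltcE/= => /andP[/eqP ime e0].
by have := h _ e0; apply: filterS => t; rewrite norm_bnorm ltcE/= ime eqxx.
Qed.

End bnorm.

(** * The unit circle in R[i] *)

Lemma lipschitz_derive (R : realType) (f df : R -> R) (M : R) :
  (forall x : R, is_derive x 1 f (df x)) -> (forall x, `|df x| <= M) ->
  forall x y, `|f x - f y| <= M * `|x - y|.
Proof.
move=> hf hM.
have fc : continuous f.
  by move=> x; apply/differentiable_continuous/derivable1_diffP; exact: ex_derive.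
have main (x y : R) : x <= y -> `|f y - f x| <= M * `|y - x|.
  move=> xy.
  have [c _ ->] := MVT_segment xy (fun z _ => hf z) (continuous_subspaceT fc).
  by rewrite normrM ler_wpM2r.
move=> x y; have [xy|/ltW yx] := leP x y; last exact: main.
by rewrite distrC [in leRHS]distrC; exact: main.
Qed.

Section cis.
Variable R : realType.
Implicit Types x y : R.

Lemma normc_cis x : Normc.normc (cis x) = 1.
Proof. by rewrite /= cos2Dsin2 sqrtr1. Qed.

Lemma cisD x y : cis (x + y) = cis x * cis y.
Proof.
rewrite /cis mulrDr cosD sinD; apply/eqP; rewrite eq_complex /=.
by rewrite eqxx /= addrC mulrC [X in _ + X]mulrC addrC [X in _ + X]mulrC addrC
  eqxx.
Qed.

Lemma cis0 : cis (0 : R) = 1.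
Proof. by rewrite /cis mulr0 cos0 sin0. Qed.

Lemma cis_neg x : cis (- x) * cis x = 1.
Proof. by rewrite -cisD addNr cis0. Qed.

Lemma cis_nat (n : nat) : cis (n%:R : R) = 1.
Proof.
elim: n => [|n IH]; first exact: cis0.
by rewrite -addn1 natrD cisD IH mul1r /cis mulr1 mulr_natl cos2pi sin2pi.
Qed.

Lemma cis_int (n : int) : cis (n%:~R : R) = 1.
Proof.
case: n => n; first exact: cis_nat.
by rewrite NegzE mulrNz; have := cis_neg (n.+1%:R : R); rewrite cis_nat mulr1.
Qed.

Lemma cis_mulrn x n : cis (x *+ n) = cis x ^+ n.
Proof.
by elim: n => [|n IH]; rewrite ?mulr0n ?cis0// mulrS cisD IH exprS.
Qed.

Lemma cis_lipschitz x y :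
  Normc.normc (cis x - cis y) <= 4 * pi * `|x - y|.
Proof.
rewrite /cis; apply: le_trans (normc_le_ReIm _ _) _.
have -> : 4 * pi * `|x - y| = `|2 * pi * x - 2 * pi * y| + `|2 * pi * x - 2 * pi * y|.
  by rewrite -mulrBr normrM gtr0_norm ?mulr_gt0 ?pi_gt0//; ring.
apply: lerD; rewrite -[leRHS]mul1r.
- apply: (@lipschitz_derive R cos (fun z => - sin z)) => z.
  by rewrite normrN sin_max.
- by apply: (@lipschitz_derive R sin (fun z => cos z)) => z; rewrite cos_max.
Qed.

Lemma normc_1_sub_cis x : Normc.normc (1 - cis x) ^+ 2 = 4 * sin (pi * x) ^+ 2.
Proof.
rewrite sqr_sqrtr ?addr_ge0 ?sqr_ge0//= sub0r sqrrN.
rewrite -mulrA mulr_natl sin_mulr2n cos_mulr2n.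
have := cos2Dsin2 (pi * x); move: (cos _) (sin _) => c s h.
have -> : c ^+ 2 = 1 - s ^+ 2 by rewrite -h addrK.
have -> : (c * s *+ 2) ^+ 2 = 4 * c ^+ 2 * s ^+ 2 by ring.
have -> : c ^+ 2 = 1 - s ^+ 2 by rewrite -h addrK.
by ring.
Qed.

Lemma cos_sqr_ge_half y : `|y| <= pi / 4 -> 1 / 2 <= cos y ^+ 2.
Proof.
move=> hy.
have : 0 <= cos (y *+ 2).
  apply: cos_ge0_pihalf; rewrite -ler_norml normrMn.
  by rewrite -mulr_natl; lra.
rewrite cos_mulr2n; lra.
Qed.

(** Up to sign the chord is 2 sin(pi x) = 4 sin y cos y for y = pi x / 2, where
    |y| <= pi / 4 keeps every cosine at least 1 / sqrt 2. *)
Lemma le_normc_1_sub_cis x : `|x| <= 1 / 2 -> `|x| <= Normc.normc (1 - cis x).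
Proof.
move=> hx.
rewrite -(@ler_pXn2r _ 2) ?nnegrE ?normc_ge0// normc_1_sub_cis.
pose y := pi * x / 2.
have hy : `|y| <= pi / 4.
  rewrite /y !normrM (ger0_norm (pi_ge0 R)) (@ger0_norm _ 2^-1) ?invr_ge0//.
  have := pi_ge0 R; nra.
have -> : pi * x = y *+ 2 by rewrite /y -mulr_natr; field.
rewrite sin_mulr2n.
(* sin y = y cos c for some c between 0 and y *)
have hs : y ^+ 2 / 2 <= sin y ^+ 2.
  have main (z : R) : 0 <= z -> `|z| <= pi / 4 -> z ^+ 2 / 2 <= sin z ^+ 2.
    move=> z0 hz.
    have sc : continuous (@sin R).
      by move=> t; apply/differentiable_continuous/derivable1_diffP;
        exact: ex_derive.
    have [c ci] := MVT_segment z0 (fun t _ => is_derive_sin t)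
      (continuous_subspaceT sc).
    rewrite sin0 !subr0 => ->; rewrite exprMn mulrC ler_wpM2r ?sqr_ge0//.
    rewrite -div1r; apply: cos_sqr_ge_half.
    move: ci; rewrite in_itv/= => /andP[c0 cz].
    by rewrite ger0_norm// (le_trans cz)// -[leLHS]ger0_norm.
  have [y0|/ltW y0] := leP 0 y; first exact: main.
  rewrite -(sqrrN (sin y)) -sinN -(sqrrN y); apply: main; first by rewrite oppr_ge0.
  by rewrite normrN.
have hc := cos_sqr_ge_half hy.
have hp : x ^+ 2 <= y ^+ 2.
  have -> : y ^+ 2 = (pi / 2) ^+ 2 * x ^+ 2 by rewrite /y; field.
  by rewrite ler_peMl ?sqr_ge0//; have := pihalf_ge1 R; nra.
rewrite real_normK ?num_real//.
have -> : 4 * (cos y * sin y *+ 2) ^+ 2 = 16 * (cos y ^+ 2 * sin y ^+ 2) by ring.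
move: hc hs hp; move: (cos y ^+ 2) (sin y ^+ 2) (sqr_ge0 y) => c s y0; nra.
Qed.

(** The chord from 1 to the point of angle x dominates the distance from x to
    the integers, which is what a Diophantine condition bounds below. *)
Lemma chord_ge x (d : R) :
  (forall n : int, d <= `|x - n%:~R|) -> d <= Normc.normc (1 - cis x).
Proof.
move=> h; pose n := Num.floor (x + 1 / 2).
have -> : cis x = cis (x - n%:~R).
  by have := cisD (x - n%:~R) n%:~R; rewrite subrK cis_int mulr1.
apply: le_trans (h n) _; apply: le_normc_1_sub_cis.
have /andP[h1 h2] := floor_itv (x + 1 / 2).
move: h2; rewrite intrD; move: h1; rewrite -/n ler_norml; lra.
Qed.

End cis.

(** * Finite differences and summation by parts *)

Section differences.
Variable R : realType.
Implicit Types (u du : R -> R) (h x : R).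

Definition bdiff h u x := u x - u (x - h).

Lemma is_derive_bdiff h u du :
  (forall x : R, is_derive x 1 u (du x)) ->
  forall x : R, is_derive x 1 (bdiff h u) (bdiff h du x).
Proof.
move=> hu x; apply: is_deriveB.
rewrite -[du (x - h)]mulr1.
apply: (@is_derive1_comp _ u (fun y => y - h)).
rewrite -[X in is_derive _ _ _ X]subr0; exact: is_deriveB.
Qed.

(** The mean value theorem trades one derivative for one factor h at each of
    the m differences. *)
Lemma bdiff_bound m : forall (v : nat -> R -> R) h M,
  (forall j (x : R), (j < m)%N -> is_derive x 1 (v j) (v j.+1 x)) ->
  (forall x, `|v m x| <= M) -> 0 <= h ->
  forall x, `|iter m (bdiff h) (v 0) x| <= h ^+ m * M.
Proof.
elim: m => [|m IH] v h M hv hM h0 x; first by rewrite expr0 mul1r; exact: hM.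
have dd : forall y : R,
    is_derive y 1 (iter m (bdiff h) (v 0)) (iter m (bdiff h) (v 1) y).
  elim: m {IH hM} hv => [|m IHm] hv y /=; first exact: hv.
  by apply: is_derive_bdiff => z; apply: IHm => j t jm; apply: hv; exact: ltnW.
have hb := IH (fun j => v j.+1) h M (fun j y jm => hv j.+1 y jm) hM h0.
have := lipschitz_derive dd hb x (x - h).
by rewrite subKr (ger0_norm h0) exprSr mulrAC.
Qed.

Lemma bdiff_supp h u b : 0 <= h -> (forall x, x <= 0 -> u x = 0) ->
  (forall x, b <= x -> u x = 0) -> forall j,
  (forall x, x <= 0 -> iter j (bdiff h) u x = 0) /\
  (forall x, b + h *+ j <= x -> iter j (bdiff h) u x = 0).
Proof.
move=> h0 u0 ub; elim=> [|j [IH1 IH2]]; first by rewrite mulr0n addr0.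
split=> x hx; rewrite iterS /bdiff.
  by rewrite !IH1 ?subr0//; lra.
rewrite !IH2 ?subr0//; move: hx; rewrite mulrSr; lra.
Qed.

(** Summation by parts: the shifted copy of the sum is z times the sum itself, up
    to its two boundary terms u (- h) and u (Q h). *)
Lemma sum_bdiff h u (z : R[i]) Q : u (- h) = 0 -> u (Q%:R * h) = 0 ->
  \sum_(n < Q.+1) (bdiff h u (n%:R * h))%:C%C * z ^+ n =
  (1 - z) * \sum_(n < Q.+1) (u (n%:R * h))%:C%C * z ^+ n.
Proof.
move=> u0 uQ; rewrite mulrBl mul1r.
under eq_bigr do rewrite /bdiff rmorphB mulrBl.
rewrite sumrB; congr (_ - _).
rewrite big_ord_recl mul0r sub0r u0 mul0r add0r.
rewrite [in RHS]big_ord_recr/= uQ mul0r addr0 mulr_sumr.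
apply: eq_bigr => i _; rewrite /bump/= add1n exprS mulrCA; congr (_ * _).
by rewrite -[X in _ - X]mul1r -mulrBl -natr1 addrK.
Qed.

(** Each difference widens the support by h, so the sum has to run m steps
    beyond the end of the support for all boundary terms to vanish. *)
Lemma sum_iter_bdiff h u (z : R[i]) Q b m : 0 < h ->
  (forall x, x <= 0 -> u x = 0) -> (forall x, b <= x -> u x = 0) ->
  b + h *+ m <= Q%:R * h ->
  \sum_(n < Q.+1) (iter m (bdiff h) u (n%:R * h))%:C%C * z ^+ n =
  (1 - z) ^+ m * \sum_(n < Q.+1) (u (n%:R * h))%:C%C * z ^+ n.
Proof.
move=> h0 u0 ub; elim: m => [|m IH] hm; first by rewrite expr0 mul1r.
have hm' : b + h *+ m <= Q%:R * h by move: hm; rewrite mulrSr; lra.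
have [s1 s2] := bdiff_supp (ltW h0) u0 ub m.
rewrite exprS -mulrA -IH// -sum_bdiff; last exact: s2.
  by [].
by apply: s1; rewrite oppr_le0 ltW.
Qed.

(** After m summations by parts the coefficients are m-th differences with mesh
    1 / N, hence of size N^-m, and there are N + m + 1 of them. *)
Lemma smooth_exp_sum m (v : nat -> R -> R) M N (z : R[i]) :
  (forall j (x : R), (j < m)%N -> is_derive x 1 (v j) (v j.+1 x)) ->
  (forall x, `|v m x| <= M) -> 0 <= M ->
  (forall x, x <= 0 -> v 0%N x = 0) -> (forall x, 1 <= x -> v 0%N x = 0) ->
  (0 < N)%N -> Normc.normc z = 1 ->
  Normc.normc (1 - z) ^+ m *
    Normc.normc (\sum_(n < N) (v 0%N (n%:R / N%:R))%:C%C * z ^+ n)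
  <= M * m.+2%:R * N%:R / N%:R ^+ m.
Proof.
move=> hv hM M0 v0 v1 N0 hz.
have N0' : 0 < (N%:R : R) by rewrite ltr0n.
pose h := (N%:R : R)^-1; have h0 : 0 < h by rewrite invr_gt0.
pose Q := (N + m)%N.
have -> : \sum_(n < N) (v 0%N (n%:R / N%:R))%:C%C * z ^+ n =
          \sum_(n < Q.+1) (v 0%N (n%:R * h))%:C%C * z ^+ n.
  rewrite -!(big_mkord xpredT (fun n => (v 0%N (n%:R * h))%:C%C * z ^+ n)).
  rewrite [RHS](@big_cat_nat _ _ _ N)/=; [|by []|by rewrite /Q leqW// leq_addr].
  rewrite [X in _ + X]big_nat [X in _ + X]big1 ?addr0// => i /andP[Ni _].
  by rewrite v1 ?mul0r// /h ler_pdivlMr// mul1r ler_nat.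
rewrite -normcX -Normc.normcM -(@sum_iter_bdiff h _ z Q 1 m)//; last first.
  rewrite /Q natrD mulrDl divff ?gt_eqF// -mulr_natl; lra.
apply: le_trans (normc_sum _ _ _) _.
have hb := bdiff_bound hv hM (ltW h0).
apply: le_trans (ler_sum (G := fun=> h ^+ m * M) _ _) _ => [i _|].
  by rewrite Normc.normcM normcX hz expr1n mulr1 normc_real; exact: hb.
rewrite sumr_const card_ord -[X in X <= _]mulr_natl /h exprVn.
have -> : M * m.+2%:R * N%:R / N%:R ^+ m = (m.+2%:R * N%:R) * (N%:R ^- m * M) by ring.
rewrite ler_wpM2r ?mulr_ge0 ?invr_ge0 ?exprn_ge0//.
by rewrite -natrM ler_nat /Q; nia.
Qed.

End differences.

(** * Regularity of weighting functions *)

Section weight_regularity.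
Variable R : realType.
Implicit Types (f g : R -> R).

(** First-order expansions with an explicit remainder can be compared on
    overlapping pieces, unlike limits of slopes within an interval. *)
Lemma is_derive_eps f (x d : R) :
  (forall e : R, 0 < e -> exists2 r, 0 < r &
    forall y, `|y - x| < r -> `|f y - f x - d * (y - x)| <= e * `|y - x|) ->
  is_derive x 1 f d.
Proof.
move=> hf.
have hc : h^-1 *: ((f \o shift x) (h *: (1 : R)) - f x) @[h --> 0^'] --> d.
  apply/cvgrPdist_le => e e0; have [r r0 hr] := hf e e0.
  rewrite /dnbhs near_withinE; apply/nbhs_ballP; exists r => //= h.
  rewrite /ball/= sub0r normrN => hh h0; have h1 : `|h| != 0 by rewrite normr_eq0.
  rewrite distrC -(@ler_pM2r _ `|h|) ?lt_def ?h1 ?normr_ge0//.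
  rewrite -normrM /shift/= scaler1.
  have := hr (h + x); rewrite addrK => /(_ hh); congr (`|_| <= _).
  rewrite /GRing.scale/=; field; exact: h0.
apply: DeriveDef; first by apply/cvg_ex; exists d.
exact: cvg_lim hc.
Qed.

Lemma deriv01_eps g (x : R) :
  cvg (slope01 g x @ within `[0, 1] x^') ->
  forall e : R, 0 < e -> exists2 r, 0 < r &
    forall y, 0 <= y <= 1 -> `|y - x| < r ->
      `|g y - g x - deriv01 g x * (y - x)| <= e * `|y - x|.
Proof.
move=> /cvgrPdist_le hg e /hg; rewrite /dnbhs near_withinE near_withinE.
move=> /nbhs_ballP[r /= r0 hr]; exists r => // y y01 yr.
have [->|yx] := eqVneq y x; first by rewrite !subrr mulr0 subr0 normr0 mulr0.
have := hr y; rewrite /ball/= distrC => /(_ yr yx).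
rewrite in_itv/= => /(_ y01).
have h1 : `|y - x| != 0 by rewrite normr_eq0 subr_eq0.
rewrite distrC -(@ler_pM2r _ `|y - x|) ?lt_def ?h1 ?normr_ge0// -normrM.
rewrite -[lim _]/(deriv01 g x); congr (`|_| <= _).
by rewrite mulrBl /slope01 divfK// subr_eq0.
Qed.

Definition extend0 g (x : R) : R := if 0 <= x <= 1 then g x else 0.

(** At an end point the slopes from outside are zero, and those from inside tend
    to the derivative there, which vanishes too. *)
Lemma is_derive_extend0 g :
  (forall x, x \in `[0, 1] -> cvg (slope01 g x @ within `[0, 1] x^')) ->
  g 0 = 0 -> g 1 = 0 -> deriv01 g 0 = 0 -> deriv01 g 1 = 0 ->
  forall x : R, is_derive x 1 (extend0 g) (extend0 (deriv01 g) x).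
Proof.
move=> hg g0 g1 d0 d1 x; apply: is_derive_eps => e e0.
have [x01|xN] := boolP (0 <= x <= 1); last first.
  have hE y : ~~ (0 <= y <= 1) -> extend0 g y = 0.
    by rewrite /extend0 => /negbTE ->.
  exists (Num.max (- x) (x - 1)).
    by rewrite lt_max oppr_gt0 subr_gt0 !ltNge -negb_and.
  move=> y yr; rewrite !hE//; last first.
    apply/negP => /andP[y0 y1]; move: yr; rewrite ltNge => /negP; apply.
    rewrite ge_max; apply/andP; split.
      by apply: le_trans (ler_norm _); rewrite lerDr.
    by rewrite distrC; apply: le_trans (ler_norm _); rewrite lerD2l lerN2.
  by rewrite /extend0 (negbTE xN) mul0r !subr0 normr0 mulr_ge0// ltW.
have [r r0 hr] := deriv01_eps (hg x x01) e0.
have xE : extend0 g x = g x by rewrite /extend0 x01.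
have dE : extend0 (deriv01 g) x = deriv01 g x by rewrite /extend0 x01.
pose s := if (x == 0) || (x == 1) then 1 else Num.min x (1 - x).
exists (Num.min r s).
  rewrite lt_min r0/= /s; case: ifPn => //; rewrite negb_or => /andP[x0 x1].
  by move/andP: x01 => [a b]; rewrite lt_min subr_gt0 !lt_def x0 a eq_sym x1 b.
move=> y; rewrite lt_min => /andP[yr ys].
have [y01|yN] := boolP (0 <= y <= 1).
  by rewrite xE dE {1}/extend0 y01; exact: hr.
have -> : extend0 g y = 0 by rewrite /extend0 (negbTE yN).
(* near an interior point the extension is g, so x is an end point *)
have [x0|x0] := eqVneq x 0.
  by rewrite xE dE x0 g0 d0 mul0r !subr0 normr0 mulr_ge0// ltW.
have [x1|x1] := eqVneq x 1.
  by rewrite xE dE x1 g1 d1 mul0r !subr0 normr0 mulr_ge0// ltW.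
move: ys; rewrite /s (negbTE x0) (negbTE x1)/= lt_min => /andP[yx y1].
case/negP: yN; apply/andP; split; apply/ltW.
  by rewrite distrC in yx; have := le_lt_trans (ler_norm _) yx; rewrite gtrBl.
by have := le_lt_trans (ler_norm _) y1; rewrite ltrD2r.
Qed.

Lemma within_continuous01 g :
  (forall x, x \in `[0, 1] -> cvg (slope01 g x @ within `[0, 1] x^')) ->
  {within `[0, 1], continuous g}.
Proof.
move=> hg; apply/subspace_continuousP => x x01.
apply/cvgrPdist_le => e e0.
have [r r0 hr] := deriv01_eps (hg x x01) (@ltr01 R).
pose D := `|deriv01 g x| + 1.
have D0 : 0 < D by rewrite ltr_wpDl.
rewrite near_withinE; apply/nbhs_ballP; exists (Num.min r (e / D)).
  by rewrite /= lt_min r0 divr_gt0.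
move=> y; rewrite /ball/= lt_min distrC => /andP[yr ye].
rewrite /= in_itv/= => y01; rewrite distrC.
have := hr y y01 yr; rewrite mul1r => hy.
rewrite ltr_pdivlMr// mulrC in ye; apply: le_trans (ltW ye).
rewrite -[g y - g x](subrK (deriv01 g x * (y - x))).
apply: le_trans (ler_normD _ _) _; rewrite normrM /D mulrDl mul1r addrC.
exact: lerD.
Qed.

Lemma bounded01 g : {within `[0, 1], continuous g} ->
  exists2 M, 0 <= M & forall x, 0 <= x <= 1 -> `|g x| <= M.
Proof.
move=> gc; have [a _ ha] := EVT_max ler01 gc; have [b _ hb] := EVT_min ler01 gc.
exists (`|g a| + `|g b|); first by rewrite addr_ge0.
move=> x x01; have := ha x; have := hb x; rewrite in_itv/= => /(_ x01) h1 /(_ x01) h2.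
have := ler_norm (g a); have := lerNnormlW (lexx `|g b|).
have := normr_ge0 (g a); have := normr_ge0 (g b).
rewrite ler_norml; lra.
Qed.

Section weight.
Variables (m : nat) (w : R -> R).
Hypothesis hw : weighting_function m w.

Let v j := extend0 (iter j (@deriv01 R) w).

Lemma weight_derive j (x : R) : (j < m)%N -> is_derive x 1 (v j) (v j.+1 x).
Proof.
move=> jm; have [hs h0 _ _] := hw.
have [w0 w1] := h0 _ (ltnW jm); have [d0 d1] := h0 _ jm.
by apply: is_derive_extend0 => // y y01; exact: hs.
Qed.

Lemma weight_bounded j : exists2 M, 0 <= M & forall x, `|v j x| <= M.
Proof.
have [hs _ _ _] := hw.
have [M M0 hM] := bounded01 (within_continuous01 (hs j)).
by exists M => // x; rewrite /v /extend0; case: ifP => [/hM//|_]; rewrite normr0.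
Qed.

Lemma weight_supp (x : R) : x <= 0 \/ 1 <= x -> v 0%N x = 0.
Proof.
have [_ h0 _ _] := hw; have [/= w0 w1] := h0 0%N (leq0n m).
rewrite /v /extend0/=; case: ifP => // /andP[x0 x1] [xl|xl].
  by have -> : x = 0 by lra.
by have -> : x = 1 by lra.
Qed.

Lemma weight_exp_sum : exists2 M, 0 <= M &
  forall N (z : R[i]), (0 < N)%N -> Normc.normc z = 1 ->
  Normc.normc (1 - z) ^+ m *
    Normc.normc (\sum_(n < N) (w (n%:R / N%:R))%:C%C * z ^+ n)
  <= M * N%:R / N%:R ^+ m.
Proof.
have [M M0 hM] := weight_bounded m.
exists (M * m.+2%:R) => [|N z N0 z1]; first by rewrite mulr_ge0.
have := smooth_exp_sum (fun j x => weight_derive x) hM M0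
  (fun x hx => weight_supp (or_introl hx))
  (fun x hx => weight_supp (or_intror hx)) N0 z1.
congr (_ * Normc.normc _ <= _); apply: eq_bigr => i _; congr (_%:C%C * _).
rewrite /v /extend0 ifT// divr_ge0//= ler_pdivrMr ?ltr0n// mul1r ler_nat.
exact: ltnW.
Qed.

Lemma weight_lipschitz : (0 < m)%N -> exists2 L, 0 <= L &
  forall x y, 0 <= x <= 1 -> 0 <= y <= 1 -> `|w x - w y| <= L * `|x - y|.
Proof.
move=> m0; have [L L0 hL] := weight_bounded 1; exists L => // x y x01 y01.
have := lipschitz_derive (fun x => weight_derive x m0) hL x y.
by rewrite /v /extend0 x01 y01.
Qed.

Lemma weight_max : exists2 W, 0 <= W & forall x, 0 <= x <= 1 -> `|w x| <= W.
Proof.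
have [W W0 hW] := weight_bounded 0; exists W => // x x01.
by have := hW x; rewrite /v /extend0 x01.
Qed.

Lemma weight_ge0 x : 0 <= x <= 1 -> 0 <= w x.
Proof.
have [_ h0 hp _] := hw; have [/= w0 w1] := h0 0%N (leq0n m) => /andP[x0 x1].
have [->|xn0] := eqVneq x 0; first by rewrite w0.
have [->|xn1] := eqVneq x 1; first by rewrite w1.
by apply/ltW/hp; rewrite !lt_def xn0 x0 eq_sym xn1 x1.
Qed.

(** The weight is bounded below on the middle part [1/3, 3/4], which contains at
    least a quarter of the nodes. *)
Lemma weight_total_ge : exists2 c, 0 < c &
  forall N, (2 <= N)%N -> c * N%:R <= weight_total w N.
Proof.
have [hs _ hp _] := hw.
have cw : {within `[1 / 3, 3 / 4], continuous w}.
  apply: continuous_subspaceW (within_continuous01 (hs 0%N)) => x /=.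
  by rewrite !in_itv/= => /andP[? ?]; apply/andP; split; lra.
have le34 : (1 / 3 : R) <= 3 / 4 by lra.
have [x0 x0i hx0] := EVT_min le34 cw.
have c0 : 0 < w x0.
  by apply: hp; move: x0i; rewrite in_itv/= => /andP[? ?]; apply/andP; split; lra.
exists (w x0 / 4) => [|N N2]; first by rewrite divr_gt0.
have N0 : 0 < (N%:R : R) by rewrite ltr0n; lia.
have in01 i : (i <= N)%N -> 0 <= (i%:R : R) / N%:R <= 1.
  by move=> iN; rewrite divr_ge0//= ler_pdivrMr// mul1r ler_nat.
(* the N / 4 + 1 nodes from N / 2 on lie in the middle part as soon as 2 <= N *)
pose a := (N./2)%N; pose b := (N./2 + (N %/ 4).+1)%N.
have bN : (b <= N)%N by rewrite /b; lia.
have ab : (a <= b)%N by rewrite /a /b; lia.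
rewrite /weight_total -(big_mkord xpredT (fun n => w (n%:R / N%:R))).
rewrite (big_cat_nat _ bN)//= (big_cat_nat _ ab)//=.
have s0 p q : (q <= N)%N -> 0 <= \sum_(p <= i < q) w (i%:R / N%:R).
  move=> qN; rewrite big_nat; apply: sumr_ge0 => i /andP[_ iq].
  by apply/weight_ge0/in01; apply: ltnW; exact: leq_trans iq qN.
have h1 : w x0 * ((N %/ 4).+1)%:R <= \sum_(a <= i < b) w (i%:R / N%:R).
  have -> : w x0 * ((N %/ 4).+1)%:R = \sum_(a <= i < b) w x0.
    by rewrite sumr_const_nat /b /a addKn mulr_natr.
  rewrite !big_nat; apply: ler_sum => i /andP[ai ib]; apply: hx0.
  rewrite in_itv/= ler_pdivlMr// ler_pdivrMr//.
  have hl : (N <= 3 * i)%N by move: ai; rewrite /a; lia.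
  have hr : (4 * i <= 3 * N)%N by move: ib; rewrite /b; lia.
  move: hl hr; rewrite -!(ler_nat R) !natrM => ? ?; apply/andP; split; lra.
have h2 : (N%:R : R) <= 4 * ((N %/ 4).+1)%:R.
  by rewrite -natrM ler_nat; lia.
have := s0 0%N a (leq_trans ab bN); have := s0 b N (leqnn N).
move: h1; nra.
Qed.

End weight.
End weight_regularity.

(** * The frequency lattice *)

Section frequency_lattice.
Variable R : realType.
Implicit Types (k : nat -> int) (J : nat).

Definition vanish_from J k := forall j, (J <= j)%N -> k j = 0.

Lemma vanish_from_le J1 J2 k :
  (J1 <= J2)%N -> vanish_from J1 k -> vanish_from J2 k.
Proof. by move=> J12 h j /(leq_trans J12)/h. Qed.

Lemma big_vanish (T : Type) (idx : T) (op : Monoid.com_law idx) J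
    (F : nat -> T) : (forall j, (J <= j)%N -> F j = idx) ->
  \big[op/idx]_(j \in [set: nat]) F j = \big[op/idx]_(j < J) F j.
Proof.
move=> hF; rewrite (@fsbigE _ _ _ _ _ (iota 0 J)) ?iota_uniq//.
  rewrite -[RHS](big_mkord xpredT) /index_iota subn0.
  by apply: eq_bigl => i; apply: mem_set.
move=> i _; rewrite mem_iota add0n/= -leqNgt; exact: hF.
Qed.

Lemma kdotE J k (x : nat -> R) : vanish_from J k ->
  kdot k x = \sum_(j < J) (k j)%:~R * x j.
Proof.
by move=> hk; apply: big_vanish => j /hk ->; rewrite mul0r.
Qed.

Lemma eta_normE J eta k : vanish_from J k ->
  eta_norm R eta k = \sum_(j < J) (jbr j ^ eta)%N%:R * `|(k j)%:~R|.
Proof.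
move=> hk; rewrite /eta_norm /eta_norm_ereal.
rewrite (nneseries_split 0 J); last by move=> j _; rewrite lee_fin mulr_ge0.
rewrite add0n eseries0; last by move=> j Jj _; rewrite hk// normr0 mulr0.
by rewrite adde0 sumEFin /= big_mkord.
Qed.

Lemma dioph_prodE J (mu : R) k : 0 < mu -> vanish_from J k ->
  dioph_prod mu k =
  \prod_(j < J) (1 + `|(k j)%:~R| `^ mu * (jbr j)%:R `^ mu).
Proof.
move=> mu0 hk; apply: big_vanish => j /hk ->.
by rewrite normr0 powR0 ?gt_eqF// mul0r addr0.
Qed.

Lemma jbr_ge1 j : (1 : R) <= (jbr j)%:R.
Proof. by rewrite ler1n /jbr leq_maxl. Qed.

Lemma norm_int_ge1 (n : int) : n != 0 -> (1 : R) <= `|n%:~R|.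
Proof. by move=> n0; rewrite -intr_norm ler1z; move: n0; lia. Qed.

(** Every nonzero coordinate contributes at least 1 to a convergent series. *)
Lemma Zstar_vanish eta k : Zstar R eta k -> exists J, vanish_from J k.
Proof.
rewrite /Zstar /eta_norm_ereal /= => hk.
pose u j : \bar R := ((jbr j ^ eta)%N%:R * `|(k j)%:~R|)%:E.
have u0 j : (0%R <= u j)%E by rewrite lee_fin mulr_ge0.
have hc := nneseries_tail_cvg hk (fun j _ => u0 j).
have lt01 : (0%:E < 1%:E :> \bar R)%E by rewrite lte_fin.
have [J _ hJ] := hc _ (open_ereal_lt' lt01).
exists J => j Jj; apply/eqP/negPn/negP => kj.
have := hJ j Jj; rewrite /=; apply/negP; rewrite -leNgt.
have := @nneseries_lim_ge R u xpredT j j.+1 (fun n _ _ => u0 n).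
rewrite big_nat1; apply: le_trans; rewrite lee_fin.
rewrite -[leLHS]mul1r ler_pM// ?norm_int_ge1//.
by rewrite ler1n expn_gt0 /jbr leq_max.
Qed.

(** * The Diophantine product *)

Lemma dioph_factor_ge (mu : R) (n : int) j : 1 < mu ->
  `|n%:~R| <= `|n%:~R : R| `^ mu * (jbr j)%:R `^ mu.
Proof.
move=> mu1; have [->|n0] := eqVneq n 0.
  by rewrite normr0 mulr_ge0 ?powR_ge0.
rewrite -[leLHS]mulr1 ler_pM//.
  by rewrite -[leLHS]powRr1// ler_powR ?norm_int_ge1// ltW.
by rewrite -[leLHS](powRr0 (jbr j)%:R) ler_powR ?jbr_ge1// ltW// (lt_trans ltr01).
Qed.

(** Each factor is 1 + a, where a is at least the absolute value of the coordinate
    because mu > 1 and the coordinate is an integer; expanding the product, only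
    the linear terms are kept. *)
Lemma dioph_prod_ge (mu : R) k J : 1 < mu -> vanish_from J k ->
  1 + \sum_(j < J) `|(k j)%:~R| <= dioph_prod mu k.
Proof.
move=> mu1 hk; rewrite (dioph_prodE _ hk) ?(lt_trans ltr01)//.
elim: J {hk} => [|J IH]; first by rewrite !big_ord0 addr0.
rewrite !big_ord_recr/= mulrDr mulr1 addrA lerD//.
apply: le_trans (dioph_factor_ge _ J mu1) _.
rewrite ler_peMl ?mulr_ge0 ?powR_ge0//; apply: le_trans IH.
by rewrite lerDl sumr_ge0.
Qed.

Lemma dioph_prod_ge1 eta (mu : R) k : 1 < mu -> Zstar R eta k ->
  1 <= dioph_prod mu k.
Proof.
move=> mu1 /Zstar_vanish[J hk]; apply: le_trans (dioph_prod_ge mu1 hk).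
by rewrite lerDl sumr_ge0.
Qed.

Lemma kdot_le eta (mu : R) k (x : nat -> R) : 1 < mu -> Zstar R eta k ->
  (forall j, 1 <= x j <= 2) -> `|kdot k x| <= 2 * dioph_prod mu k.
Proof.
move=> mu1 /Zstar_vanish[J hk] hx; rewrite (kdotE _ hk).
apply: le_trans (ler_norm_sum _ _ _) _.
have := dioph_prod_ge mu1 hk; rewrite -(ler_pM2l (@ltr0n R 2)).
apply: le_trans; rewrite mulrDr mulr1 mulr_sumr ler_wpDl//.
apply: ler_sum => i _; rewrite normrM mulrC ler_wpM2r//.
have /andP[x1 x2] := hx i; rewrite ger0_norm//; lra.
Qed.

(** * Summability over the lattice *)

(** The tails telescope, since 1 / n^2 <= 2 (1 / n - 1 / (n + 1)). *)
Lemma sum_inv_sqr_le (c : int -> R) (Q : R) : 0 <= Q -> c 0 = 1 ->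
  (forall n, n != 0 -> c n <= Q / n%:~R ^+ 2) ->
  forall N, \sum_(t < (N.*2).+1) c (t%:Z - N%:Z) <= 1 + 4 * Q * (1 - N.+1%:R^-1).
Proof.
move=> Q0 c0 cn; elim=> [|N IH].
  by rewrite big_ord_recl big_ord0 /= subr0 c0 addr0 invr1 subrr mulr0 addr0.
rewrite doubleS big_ord_recl big_ord_recr/=.
have -> : \sum_(i < N.*2.+1)
     c ((bump 0 (widen_ord (leqnSn N.*2.+1) i))%:Z - N.+1%:Z)
   = \sum_(t < (N.*2).+1) c (t%:Z - N%:Z).
  by apply: eq_bigr => i _; congr (c _); rewrite /bump /=; lia.
have h1 : c (0%:Z - N.+1%:Z) <= Q / (N.+1%:R) ^+ 2.
  rewrite sub0r; have := cn (- N.+1%:Z); rewrite mulrNz sqrrN; apply; lia.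
have h2 : c ((bump 0 N.*2.+1)%:Z - N.+1%:Z) <= Q / (N.+1%:R) ^+ 2.
  have -> : (bump 0 N.*2.+1)%:Z - N.+1%:Z = N.+1%:Z by rewrite /bump/=; lia.
  by apply: cn; lia.
have n0 : (0 : R) < N.+1%:R by rewrite ltr0n.
have n1 : (N.+1%:R : R) >= 1 by rewrite ler1n.
have n2 : (N.+2%:R : R) = N.+1%:R + 1 by rewrite -natr1.
have h3 : 2 * (Q / (N.+1%:R) ^+ 2) <= 4 * Q * (N.+1%:R^-1 - N.+2%:R^-1).
  rewrite n2; move: N.+1%:R n0 n1 => x x0 x1.
  have -> : 4 * Q * (x^-1 - (x + 1)^-1) = 2 * (Q / x ^+ 2) * (2 * x / (x + 1)).
    by field; lra.
  rewrite ler_peMr ?mulr_ge0 ?invr_ge0 ?sqr_ge0//.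
  by rewrite ler_pdivlMr; lra.
move: IH h1 h2 h3; move: (\sum_(_ < _) _) (c _) (c _) (Q / _) => s c1 c2 q.
move: (N.+1%:R^-1) (N.+2%:R^-1) => x1 x2; lra.
Qed.

Lemma sum_inv_jbr_sqr J : \sum_(j < J) (jbr j)%:R ^- 2 <= 3 :> R.
Proof.
case: J => [|J]; first by rewrite big_ord0.
have h : \sum_(j < J) (j.+1%:R ^- 2 : R) <= 2 * (1 - J.+1%:R^-1).
  elim: J => [|J IH]; first by rewrite big_ord0 invr1 subrr mulr0.
  rewrite big_ord_recr/=.
  have n0 : (0 : R) < J.+1%:R by rewrite ltr0n.
  have n1 : (J.+1%:R : R) >= 1 by rewrite ler1n.
  have n2 : (J.+2%:R : R) = J.+1%:R + 1 by rewrite -natr1.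
  have h3 : J.+1%:R ^- 2 <= 2 * (J.+1%:R^-1 - J.+2%:R^-1) :> R.
    rewrite n2; move: J.+1%:R n0 n1 => x x0 x1.
    have -> : 2 * (x^-1 - (x + 1)^-1) = x ^- 2 * (2 * x / (x + 1)).
      by field; lra.
    by rewrite ler_peMr ?invr_ge0 ?sqr_ge0// ler_pdivlMr; lra.
  move: IH h3; move: (\sum_(_ < _) _) (J.+1%:R ^- 2) => s q.
  move: (J.+1%:R^-1) (J.+2%:R^-1) => x1 x2; lra.
rewrite big_ord_recl /= /jbr /= expr1n invr1.
under eq_bigr => i _ do rewrite /bump/= add1n maxnE subn1/= addnC/= addn1.
have : 0 <= (J.+1%:R : R)^-1 by rewrite invr_ge0.
by move: h; move: (\sum_(_ < _) _) (J.+1%:R^-1) => s q; lra.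
Qed.

(** The exponential dominates the term of degree p + 2 of its own series. *)
Lemma expRN_poly_le (sigma : R) p : 0 < sigma -> exists2 A, 0 <= A &
  forall y, 1 <= y -> expR (- (sigma * y)) * y ^+ p <= A / y ^+ 2.
Proof.
move=> s0; exists (p.+2`!%:R / sigma ^+ p.+2).
  by rewrite divr_ge0// exprn_ge0// ltW.
move=> y y1; have y0 : 0 < y by lra.
have sy0 : 0 < sigma * y by rewrite mulr_gt0.
have h : (sigma * y) ^+ p.+2 / p.+2`!%:R <= expR (sigma * y).
  by apply: le_trans (expR_ge1Dxn p.+1 (ltW sy0)); rewrite lerDr.
have f0 : (0 : R) < p.+2`!%:R by rewrite ltr0n fact_gt0.
rewrite expRN ler_pdivlMr ?exprn_gt0// -mulrA -exprD addn2.
rewrite mulrC ler_pdivrMr ?expR_gt0//.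
rewrite mulrAC ler_pdivlMr ?exprn_gt0// mulrC -exprMn.
by rewrite -ler_pdivrMl// mulrC.
Qed.

(** The j-th coordinate's share of exp(- sigma |k|_eta) times the m-th power of
    the Diophantine product. *)
Definition lattice_factor (sigma mu : R) (eta m j : nat) (n : int) : R :=
  expR (- (sigma * ((jbr j ^ eta)%N%:R * `|n%:~R|))) *
    (1 + `|n%:~R| `^ mu * (jbr j)%:R `^ mu) ^+ m.

(** Both parts of the factor are controlled by y = <j> |n| >= 1: the exponential
    is at most exp(- sigma y), the polynomial part at most 2^m y^(p m), where p
    is an integer above mu. *)
Lemma lattice_factor_le (sigma mu : R) (eta m : nat) :
  0 < sigma -> 1 < mu -> (0 < eta)%N -> exists2 A, 0 <= A &
  forall j n, n != 0 -> lattice_factor sigma mu eta m j n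
                        <= A / (jbr j)%:R ^+ 2 / n%:~R ^+ 2.
Proof.
move=> s0 mu1 e0; pose p := `|Num.ceil mu|%N.
have [A A0 hA] := expRN_poly_le (p * m) s0.
exists (2 ^+ m * A) => [|j n n0]; first by rewrite mulr_ge0// exprn_ge0.
pose y : R := (jbr j)%:R * `|n%:~R|.
have y1 : 1 <= y by rewrite -[leLHS]mulr1 ler_pM ?jbr_ge1 ?norm_int_ge1.
have y0 : 0 < y by lra.
have -> : 2 ^+ m * A / (jbr j)%:R ^+ 2 / n%:~R ^+ 2 = 2 ^+ m * (A / y ^+ 2).
  by rewrite /y exprMn real_normK ?num_real// (invfM (_ ^+ 2)) (mulrA A) 2!(mulrA (2 ^+ m)).
apply: le_trans (ler_wpM2l (exprn_ge0 m (ler0n R 2)) (hA y y1)).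
rewrite mulrCA; apply: ler_pM => //; rewrite ?expR_ge0//.
- rewrite ler_expR lerN2 ler_wpM2l ?(ltW s0)// ler_wpM2r// ler_nat.
  by rewrite -{1}(expn1 (jbr j)) leq_pexp2l// /jbr leq_max.
rewrite exprM -exprMn; apply: lerXn2r.
- by rewrite nnegrE addr_ge0// mulr_ge0// powR_ge0.
- by rewrite nnegrE mulr_ge0// exprn_ge0// ltW.
rewrite mulrC -powRM// -/y.
have h : y `^ mu <= y ^+ p.
  rewrite -powR_mulrn ?(ltW y0)// ler_powR//.
  have c0 : 0 <= Num.ceil mu by rewrite ceil_ge0; lra.
  by rewrite /p natr_absz (ger0_norm c0) ceil_ge.
have h1 : 1 <= y ^+ p by rewrite exprn_ege1.
lra.
Qed.

(** Exponential decay in the weighted norm beats any power of the Diophantine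
    product. Both are products over the coordinates, so a finite sum over the
    lattice is dominated by a product of one-dimensional sums, the j-th of which
    is at most 1 + C / <j> ^ 2; the product of these is bounded. *)
Lemma lattice_sum (sigma mu : R) (eta m : nat) :
  0 < sigma -> 1 < mu -> (0 < eta)%N -> exists2 S, 0 <= S &
  forall (I : finType) (k : I -> nat -> int), injective k ->
    (forall i, Zstar R eta (k i)) ->
    \sum_i expR (- (sigma * eta_norm R eta (k i))) * dioph_prod mu (k i) ^+ m
    <= S.
Proof.
move=> s0 mu1 e0; have [A A0 hA] := lattice_factor_le m s0 mu1 e0.
have mu0 : 0 < mu by rewrite (lt_trans ltr01).
exists (expR (12 * A)); first exact: expR_ge0.
move=> I k kinj kZ.
have [Jf hJf] := boolp.choice (fun i => Zstar_vanish (kZ i)).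
pose J := \max_i Jf i.
have hJ i : vanish_from J (k i).
  by apply: vanish_from_le (hJf i); exact: leq_bigmax.
pose N := \max_(i : I) \max_(j < J) `|k i j|%N.
have hN i (j : 'I_J) : (`|k i j| <= N)%N.
  apply: leq_trans (leq_bigmax (F := fun i => \max_(j < J) `|k i j|%N) i).
  exact: (leq_bigmax (F := fun j : 'I_J => `|k i j|%N)).
pose a := lattice_factor sigma mu eta m.
have a_ge0 j n : 0 <= a j n.
  rewrite mulr_ge0 ?expR_ge0// exprn_ge0// addr_ge0// mulr_ge0// powR_ge0.
(* Shifting the coordinates from [-N, N] to [0, 2 N] embeds the frequencies into
   a finite function type, over which a sum of products is a product of sums. *)
pose dec (t : 'I_(N.*2).+1) : int := t%:Z - N%:Z.
pose enc i : {ffun 'I_J -> 'I_(N.*2).+1} :=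
  [ffun j : 'I_J => inord (absz (k i j + N%:Z))].
have encK i (j : 'I_J) : dec (enc i j) = k i j.
  rewrite /dec ffunE inordK; have := hN i j; lia.
have enc_inj : injective enc.
  move=> i1 i2 h; apply: kinj; apply/funext => j.
  have [jJ|Jj] := ltnP j J; last by rewrite !hJ.
  by rewrite -(encK i1 (Ordinal jJ)) h encK.
have -> : \sum_i expR (- (sigma * eta_norm R eta (k i)))
              * dioph_prod mu (k i) ^+ m
        = \sum_i \prod_(j < J) a j (dec (enc i j)).
  apply: eq_bigr => i _; rewrite (eta_normE _ (hJ i)) (dioph_prodE mu0 (hJ i)).
  rewrite mulr_sumr -sumrN expR_sum -prodrXl -big_split/=.
  by apply: eq_bigr => j _; rewrite encK.
have -> : \sum_i \prod_(j < J) a j (dec (enc i j)) =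
    \sum_(g in [set enc i | i in I]%SET) \prod_(j < J) a j (dec (g j)).
  by rewrite big_imset//= => i1 i2 _ _; exact: enc_inj.
apply: le_trans (_ : \sum_(g : {ffun 'I_J -> 'I_(N.*2).+1})
    \prod_(j < J) a j (dec (g j)) <= _).
  rewrite [leRHS](bigID (mem [set enc i | i in I]%SET))/= lerDl sumr_ge0// => g _.
  by rewrite prodr_ge0.
rewrite -(bigA_distr_bigA (fun (j : 'I_J) t => a j (dec t))).
apply: le_trans (_ : \prod_(j < J) expR (4 * A * (jbr j)%:R ^- 2) <= _).
  apply: ler_prod => j _; rewrite sumr_ge0//=.
  apply: le_trans (expR_ge1Dx _).
  have Q0 : 0 <= A / (jbr j)%:R ^+ 2 by rewrite divr_ge0// exprn_ge0.
  have a0 : a j 0 = 1.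
    rewrite /a /lattice_factor normr0 mulr0 mulr0 oppr0 expR0 powR0 ?gt_eqF//.
    by rewrite mul0r addr0 expr1n mulr1.
  apply: le_trans (sum_inv_sqr_le Q0 a0 (fun n => hA j n) N) _.
  rewrite lerD2l -[leRHS]mulrA ler_piMr//; first by rewrite mulr_ge0.
rewrite -expR_sum ler_expR -mulr_sumr.
have := sum_inv_jbr_sqr J; nra.
Qed.

End frequency_lattice.

(** * Characters along orbits *)

Section characters.
Variable R : realType.
Implicit Types (k : nat -> int) (rho : nat -> R) (theta : torus R).

(** Reducing the coordinates modulo 1 changes k.x by an integer. *)
Lemma character_torus_proj eta k (x : nat -> R) : Zstar R eta k ->
  character k (torus_proj x) = cis (kdot k x).
Proof.
move=> /Zstar_vanish[J hk]; rewrite /character !(kdotE _ hk) /=.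
pose n : int := \sum_(j < J) k j * Num.floor (x j).
have -> : \sum_(j < J) (k j)%:~R * x j =
    \sum_(j < J) (k j)%:~R * (x j - (Num.floor (x j))%:~R) + n%:~R.
  rewrite /n (raddf_sum (intmul (1 : R)))/= -big_split/=.
  by apply: eq_bigr => j _; rewrite intrM -mulrDr subrK.
by rewrite cisD cis_int mulr1.
Qed.

Lemma kdotD eta k (x y : nat -> R) : Zstar R eta k ->
  kdot k (fun j => x j + y j) = kdot k x + kdot k y.
Proof.
move=> /Zstar_vanish[J hk]; rewrite !(kdotE _ hk) -big_split/=.
by apply: eq_bigr => j _; rewrite mulrDr.
Qed.

Lemma kdotZ eta k (x : nat -> R) t : Zstar R eta k ->
  kdot k (fun j => x j * t) = kdot k x * t.
Proof.
move=> /Zstar_vanish[J hk]; rewrite !(kdotE _ hk) mulr_suml.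
by apply: eq_bigr => j _; rewrite mulrA.
Qed.

Lemma character_rotation eta k rho theta n : Zstar R eta k ->
  character k (iter n (rotation rho) theta) =
  character k theta * cis (kdot k rho) ^+ n.
Proof.
move=> hk; elim: n => [|n IH]; first by rewrite expr0 mulr1.
rewrite iterS /rotation (character_torus_proj _ hk) (kdotD _ _ hk) cisD.
by rewrite -[cis (kdot k (fun j => _))]/(character k _) IH exprSr mulrA.
Qed.

Lemma character_flow eta k rho theta t : Zstar R eta k ->
  character k (flow rho t theta) = character k theta * cis (kdot k rho * t).
Proof.
move=> hk; rewrite /flow (character_torus_proj _ hk) (kdotD _ _ hk).
by rewrite (kdotZ _ _ hk) cisD mulrC.
Qed.

Lemma normc_character k theta : Normc.normc (character k theta) = 1.
Proof. exact: normc_cis. Qed.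

Lemma Zstar0 eta : Zstar R eta (fun=> 0).
Proof.
rewrite /Zstar /eta_norm_ereal /= eseries0// => j _ _.
by rewrite normr0 mulr0.
Qed.

Lemma character0 theta : character (fun=> 0) theta = 1.
Proof.
rewrite /character (@kdotE _ 0)// big_ord0; exact: cis0.
Qed.

End characters.

(** * Linear combinations of values of an almost periodic function *)

Section fourier.
Context (R : realType) (B : completeNormedModType R[i]).
Variables (vol : probability (torus R) R) (eta : nat) (f : torus R -> B).
Hypothesis fourier_series : forall theta,
  partial_sum (fun k : Zstar R eta =>
    character (val k) theta *: fourier_coeff vol f (val k))
  @ totally --> f theta.

Lemma fourier_coeff0 : fourier_coeff vol f (fun=> 0) = bochner_integral vol setT f.
Proof.
rewrite /fourier_coeff; congr (bochner_integral _ _ _); apply/funext => theta.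
have -> : (fun j : nat => - (fun=> 0 : int) j) = (fun=> 0).
  by apply/funext => j; rewrite oppr0.
by rewrite character0 scale1r.
Qed.

(** Inserting the Fourier series, a linear combination of values of f differs
    from the same combination of constants by a series whose k-th term carries
    the factor sum_i c_i chi_k(theta_i). Discrete averages, Riemann sums and
    increments of f along the flow are all of this form. *)
Lemma fourier_combination (I : finType) (c : I -> R[i]) (theta : I -> torus R)
    (g : (nat -> int) -> R) (S : R) :
  (forall k, Zstar R eta k -> 0 <= g k) ->
  (forall k, Zstar R eta k -> k <> (fun=> 0) ->
     Normc.normc (\sum_i c i * character k (theta i)) *
       bnorm (fourier_coeff vol f k) <= g k) ->
  (forall (J : finType) (k : J -> nat -> int), injective k ->
     (forall j, Zstar R eta (k j)) -> \sum_j g (k j) <= S) ->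
  bnorm (\sum_i c i *: f (theta i)
         - (\sum_i c i) *: bochner_integral vol setT f) <= S.
Proof.
move=> g0 hg hS; apply/ler_addgt0Pr => e e0.
pose C := \sum_i Normc.normc (c i).
have C0 : 0 <= C by apply: sumr_ge0 => i _; exact: normc_ge0.
have C1 : 0 < C + 1 by rewrite ltr_wpDl.
pose ps i := partial_sum (fun k : Zstar R eta =>
    character (val k) (theta i) *: fourier_coeff vol f (val k)).
have FF : ProperFilter (@totally (Zstar R eta)) by exact: totally_filter.
have hnear : \forall A \near totally, forall i,
    bnorm (f (theta i) - ps i A) < e / (C + 1).
  apply: filter_forall => i.
  by have /cvg_bnorm := @fourier_series (theta i); apply; rewrite divr_gt0.
pose k0 : Zstar R eta := SigSub (mem_set (Zstar0 R eta)).
have hk0 : \forall A \near totally, k0 \in (A : {fset Zstar R eta}).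
  exists [fset k0]%fset => // A /=; by rewrite fsub1set.
have [A [hA k0A]] := filter_ex (filterI hnear hk0).
apply: le_trans (bnorm_triangle _ (\sum_i c i *: ps i A) _) _.
rewrite addrC; apply: lerD; last first.
  rewrite -sumrB; apply: le_trans (bnorm_sum _ _ _) _.
  apply: le_trans (_ : \sum_i Normc.normc (c i) * (e / (C + 1)) <= _).
    apply: ler_sum => i _; rewrite -scalerBr bnormZ ler_wpM2l ?normc_ge0//.
    exact: ltW (hA i).
  rewrite -mulr_suml -/C mulrCA ger_pMr// ler_pdivrMr// mul1r; lra.
have -> : \sum_i c i *: ps i A =
    \sum_(k : A) (\sum_i c i * character (val (val k)) (theta i))
       *: fourier_coeff vol f (val (val k)).
  rewrite /ps /partial_sum; under eq_bigr do rewrite scaler_sumr.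
  rewrite exchange_big/=; apply: eq_bigr => k _; rewrite scaler_suml.
  by apply: eq_bigr => i _; rewrite scalerA.
rewrite (bigD1 [` k0A]%fset)//= fourier_coeff0.
under [X in X *: _ + _]eq_bigr do rewrite character0 mulr1.
rewrite addrC addKr.
apply: le_trans (bnorm_sum _ _ _) _.
apply: le_trans (_ : \sum_(k : A) g (val (val k)) <= _); last first.
  apply: hS => [x y|x]; first by move=> /val_inj/val_inj.
  exact: set_mem (valP (val x)).
rewrite [leRHS](bigD1 [` k0A]%fset)//= ler_wpDl//.
  by apply: g0; exact: Zstar0.
apply: ler_sum => k kn0; rewrite bnormZ; apply: hg.
  exact: set_mem (valP (val k)).
by move=> h; case/eqP: kn0; apply/val_inj/val_inj.
Qed.

End fourier.

(** Exponential decay of the Fourier coefficients pays for any fixed power of the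
    Diophantine product in the bound on the character sums. *)
Lemma analytic_combination (R : realType) (B : completeNormedModType R[i])
    (vol : probability (torus R) R) (eta : nat) (mu : R) (m : nat)
    (f : torus R -> B) : (0 < eta)%N -> 1 < mu ->
  (forall theta, partial_sum (fun k : Zstar R eta =>
    character (val k) theta *: fourier_coeff vol f (val k))
    @ totally --> f theta) ->
  analytic_torus vol eta f ->
  exists2 S : R, 0 <= S & forall (I : finType) (c : I -> R[i])
    (theta : I -> torus R) (K : R), 0 <= K ->
    (forall k, Zstar R eta k -> k <> (fun=> 0) ->
       Normc.normc (\sum_i c i * character k (theta i))
         <= K * dioph_prod mu k ^+ m) ->
    bnorm (\sum_i c i *: f (theta i)
           - (\sum_i c i) *: bochner_integral vol setT f) <= K * S.
Proof.
move=> e0 mu1 hf [sigma s0 [M hM]].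
have [S S0 hS] := lattice_sum m s0 mu1 e0.
exists (`|M| * S) => [|I c theta K K0 hK]; first by rewrite mulr_ge0.
pose g k := K * `|M| *
  (expR (- (sigma * eta_norm R eta k)) * dioph_prod mu k ^+ m).
have p1 k : Zstar R eta k -> 1 <= dioph_prod mu k by exact: dioph_prod_ge1.
have p0 k : Zstar R eta k -> 0 <= dioph_prod mu k ^+ m.
  by move=> /p1 h; rewrite exprn_ge0// (le_trans ler01).
apply: (fourier_combination (g := g) hf).
- by move=> k kZ; rewrite /g !mulr_ge0 ?expR_ge0 ?p0.
- move=> k kZ kn0.
  have -> : g k = (K * dioph_prod mu k ^+ m) *
      (expR (- (sigma * eta_norm R eta k)) * `|M|) by rewrite /g; ring.
  apply: ler_pM; rewrite ?normc_ge0 ?bnorm_ge0 ?hK//.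
  rewrite expRN mulrC ler_pdivlMr ?expR_gt0// mulrC.
  exact: le_trans (hM k kZ kn0) (ler_norm M).
- move=> J k kinj kZ; rewrite -mulr_sumr mulrA ler_wpM2l ?mulr_ge0//.
  exact: hS.
Qed.

(** * Bochner integrals and partitions *)

Section partitions.
Context d (T : measurableType d) (R : realType).
Variable mu : {measure set T -> \bar R}.

Lemma integral_preimages (D : set T) (J : choiceType) (q : T -> J) (r : seq J)
    (h : T -> \bar R) : measurable D -> uniq r ->
  (forall x, D x -> q x \in r) -> (forall j, measurable (q @^-1` [set j])) ->
  measurable_fun D h -> (forall x, D x -> (0 <= h x)%E) ->
  (\int[mu]_(x in D) h x =
   \sum_(j <- r) \int[mu]_(x in D `&` q @^-1` [set j]) h x)%E.
Proof.
move=> mD ur qr mq mh h0.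
have DE : D = \big[setU/set0]_(j <- r) (D `&` q @^-1` [set j]).
  rewrite -bigcup_seq; apply/seteqP; split=> [x Dx|x [j _ []]//].
  by exists (q x); [exact: qr|split].
rewrite [in LHS]DE ge0_integral_bigsetU -?DE//.
- by move=> j; exact: measurableI.
- by move=> i j _ _ [x [[_ /= <-] [_ <-]]].
Qed.

Lemma measure_preimages (D : set T) (J : choiceType) (q : T -> J) (r : seq J) :
  measurable D -> uniq r ->
  (forall x, D x -> q x \in r) -> (forall j, measurable (q @^-1` [set j])) ->
  (mu D = \sum_(j <- r) mu (D `&` q @^-1` [set j]))%E.
Proof.
move=> mD ur qr mq.
have := @integral_preimages D J q r (cst 1%E) mD ur qr mq
  (measurable_cst _) (fun _ _ => lee01).
rewrite integral_cst// mul1e => ->; apply: eq_bigr => j _.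
by rewrite integral_cst ?mul1e//; exact: measurableI.
Qed.

Lemma fine_measure_preimages (D : set T) (J : choiceType) (q : T -> J)
    (r : seq J) : measurable D -> (mu D < +oo)%E -> uniq r ->
  (forall x, D x -> q x \in r) -> (forall j, measurable (q @^-1` [set j])) ->
  fine (mu D) = \sum_(j <- r) fine (mu (D `&` q @^-1` [set j])).
Proof.
move=> mD fD ur qr mq; rewrite (measure_preimages mD ur qr mq) sum_fine// => j _.
rewrite ge0_fin_numE//; apply: le_lt_trans fD.
by apply: le_measure; rewrite ?inE//; exact: measurableI.
Qed.

Section bochner.
Context (B : completeNormedModType R[i]) (D : set T).
Hypotheses (mD : measurable D) (fD : (mu D < +oo)%E).
Variable F : T -> B.
Hypothesis mF : forall b, measurable_fun D (fun x => bnorm (F x - b)).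

Lemma measurable_dist_bsimple s : bsimple mu D s ->
  measurable_fun D (fun x => bnorm (F x - s x)).
Proof.
move=> [fs ms _] _ Y mY.
have -> : D `&` (fun x => bnorm (F x - s x)) @^-1` Y =
    \bigcup_(v in range s) ((D `&` (fun x => bnorm (F x - v)) @^-1` Y)
                            `&` s @^-1` [set v]).
  apply/seteqP; split=> [x [Dx Yx]|x [v _ [[Dx Yx] /= sx]]].
    by exists (s x) => //; split.
  by split=> //=; rewrite sx.
by apply: fin_bigcup_measurable => // v _; apply: measurableI => //; exact: mF.
Qed.

(** On each cell of the common refinement of the level sets of s and of the
    partition p, both functions are constant, and their difference there is at
    most the distance from F to s plus the distance from F to c. *)
Lemma bsimple_integral_riemann (I : finType) (p : T -> I) (c : I -> B)
    (s : T -> B) (e : R) :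
  bsimple mu D s -> (forall i, measurable (p @^-1` [set i])) ->
  (forall x, D x -> bnorm (F x - c (p x)) <= e) ->
  ((bnorm (bsimple_integral mu D s
           - \sum_i (fine (mu (D `&` p @^-1` [set i])))%:C%C *: c i))%:E <=
   \int[mu]_(x in D) (bnorm (F x - s x))%:E + (e * fine (mu D))%:E)%E.
Proof.
move=> hs mp hc; have [fs ms _] := hs.
(* e may be negative only if D is empty *)
have [D0|D0] := pselect (D !=set0); last first.
  have DE : D = set0 by apply/seteqP; split=> // x Dx; case: D0; exists x.
  rewrite /bsimple_integral DE.
  rewrite fsbig1 => [|v _]; last by rewrite set0I measure0/= scale0r.
  rewrite big1 => [|v _]; last by rewrite set0I measure0/= scale0r.
  by rewrite subrr bnorm0 integral_set0 measure0/= mulr0 adde0.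
have e0 : 0 <= e by case: D0 => x /hc; apply: le_trans; exact: bnorm_ge0.
pose V := fset_set (range s).
have sV x : D x -> s x \in V by rewrite in_fset_set// => _; apply/mem_set; exists x.
have pI x : D x -> p x \in enum I by rewrite mem_enum.
pose E v i := D `&` s @^-1` [set v] `&` p @^-1` [set i].
have mE v i : measurable (E v i) by apply: measurableI => //; exact: measurableI.
have fE (A : set T) : measurable A -> A `<=` D -> (mu A < +oo)%E.
  by move=> mA AD; apply: le_lt_trans fD; apply: le_measure; rewrite ?inE.
have msI v : measurable (D `&` s @^-1` [set v]) by exact: measurableI.
have mpI i : measurable (D `&` p @^-1` [set i]) by exact: measurableI.
have h1 : bsimple_integral mu D s =
    \sum_(v <- V) \sum_i (fine (mu (E v i)))%:C%C *: v.
  rewrite /bsimple_integral fsbig_finite//; apply: eq_bigr => v _.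
  rewrite (@fine_measure_preimages _ _ p (enum I))//.
  - by rewrite rmorph_sum/= scaler_suml big_enum.
  - by apply: fE => // x [].
  - exact: enum_uniq.
  - by move=> x [Dx _]; exact: pI.
have h2 : \sum_i (fine (mu (D `&` p @^-1` [set i])))%:C%C *: c i =
    \sum_(v <- V) \sum_i (fine (mu (E v i)))%:C%C *: c i.
  rewrite exchange_big/=; apply: eq_bigr => i _.
  rewrite (@fine_measure_preimages _ _ s V)//.
  - rewrite rmorph_sum/= scaler_suml; apply: eq_bigr => v _.
    by rewrite /E setIAC.
  - by apply: fE => // x [].
  - by move=> x [Dx _]; exact: sV.
pose h x := bnorm (F x - s x) + e.
have mh : measurable_fun D h.
  by apply: measurable_funD; [exact: measurable_dist_bsimple|exact: measurable_cst].
have h0 x : 0 <= h x by rewrite addr_ge0// bnorm_ge0.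
have h3 : (\int[mu]_(x in D) (h x)%:E =
    \sum_(v <- V) \sum_i \int[mu]_(x in E v i) (h x)%:E)%E.
  rewrite (@integral_preimages _ _ s V)//; first last.
  - by move=> x _; rewrite lee_fin.
  - exact/measurable_EFinP.
  apply: eq_bigr => v _; rewrite (@integral_preimages _ _ p (enum I))//.
  - by rewrite big_enum.
  - exact: enum_uniq.
  - by move=> x [Dx _]; exact: pI.
  - apply/measurable_EFinP; apply: (measurable_funS mD) mh => x [] //.
  - by move=> x _; rewrite lee_fin.
have -> : (\int[mu]_(x in D) (bnorm (F x - s x))%:E + (e * fine (mu D))%:E =
    \int[mu]_(x in D) (h x)%:E)%E.
  under [RHS]eq_integral do rewrite EFinD.
  rewrite ge0_integralD//.
  - congr (_ + _)%E; rewrite (integral_cst _ mD) EFinM fineK//.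
    by rewrite ge0_fin_numE.
  - by move=> x _; rewrite lee_fin bnorm_ge0.
  - by apply/measurable_EFinP; exact: measurable_dist_bsimple.
rewrite h1 h2 h3 -sumrB.
apply: (@le_trans _ _
  (\sum_(v <- V) \sum_i (fine (mu (E v i)) * bnorm (v - c i))%:E)%E).
  under [leRHS]eq_bigr do rewrite sumEFin; rewrite sumEFin lee_fin.
  apply: le_trans (bnorm_sum _ _ _) _; apply: ler_sum => v _.
  rewrite -sumrB; apply: le_trans (bnorm_sum _ _ _) _; apply: ler_sum => i _.
  by rewrite -scalerBr bnormZ normc_real ger0_norm// fine_ge0.
apply: lee_sum => v _; apply: lee_sum => i _.
have -> : ((fine (mu (E v i)) * bnorm (v - c i))%:E =
    \int[mu]_(x in E v i) (bnorm (v - c i))%:E)%E.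
  rewrite (integral_cst _ (mE v i)) mulrC EFinM fineK// ge0_fin_numE//.
  by apply: fE => // x [[]].
apply: ge0_le_integral => //.
- by move=> x _; rewrite lee_fin bnorm_ge0.
- by apply/measurable_EFinP; apply: (measurable_funS mD) mh => x [[]].
- move=> x [[Dx /= sx] /= px]; rewrite lee_fin /h -sx -px.
  apply: le_trans (bnorm_triangle _ (F x) _) _.
  by rewrite bnormB lerD// hc.
Qed.

Lemma bsimple_finType (I : finType) (p : T -> I) (c : I -> B) :
  (forall i, measurable (p @^-1` [set i])) -> bsimple mu D (c \o p).
Proof.
move=> mp.
have mc v : measurable ((c \o p) @^-1` [set v]).
  have -> : (c \o p) @^-1` [set v] =
      \bigcup_(i in [set i | c i = v]) (p @^-1` [set i]).
    by apply/seteqP; split=> [x /= <-|x [i /= <- /= <-]]//; exists (p x).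
  by apply: fin_bigcup_measurable => //; exact: finite_finset.
split=> //.
- apply: (@sub_finite_set _ _ (range c)).
    by move=> _ [x _ <-]; exists (p x).
  exact/finite_image/finite_finset.
- move=> v _; apply: le_lt_trans fD; apply: le_measure; rewrite ?inE//.
  exact: measurableI.
Qed.

(** For partitions on whose cells F oscillates less and less, this makes the
    Bochner integral unique and computes it as a limit. *)
Lemma bochner_riemann (I : finType) (p : T -> I) (c : I -> B) (e : R) (v : B) :
  is_bochner_integral mu D F v -> (forall i, measurable (p @^-1` [set i])) ->
  (forall x, D x -> bnorm (F x - c (p x)) <= e) ->
  bnorm (v - \sum_i (fine (mu (D `&` p @^-1` [set i])))%:C%C *: c i)
    <= e * fine (mu D).
Proof.
move=> [s [hs _ hint hv]] mp hc; apply/ler_addgt0Pr => r r0.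
have r20 : 0 < r / 2 by rewrite divr_gt0.
have r2e : (0%:E < (r / 2)%:E :> \bar R)%E by rewrite lte_fin.
have h1 : \forall n \near \oo,
    (\int[mu]_(x in D) (bnorm (F x - s n x))%:E < (r / 2)%:E)%E.
  exact: hint _ (open_ereal_lt' r2e).
have h2 : \forall n \near \oo, bnorm (v - bsimple_integral mu D (s n)) < r / 2.
  by move/cvg_bnorm: hv; apply.
have [n [/= hn1 hn2]] := filter_ex (filterI h1 h2).
apply: le_trans (bnorm_triangle _ (bsimple_integral mu D (s n)) _) _.
have := bsimple_integral_riemann (hs n) mp hc.
move=> /le_trans-/(_ _ (leeD (ltW hn1) (lexx _))).
rewrite -EFinD lee_fin; move: hn2; lra.
Qed.

(** The integrals of two step functions are close because both are close to the
    Riemann sum of one of them; completeness of B then provides the limit. *)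
Lemma bochner_integrable_riemann (I : nat -> finType) (p : forall n, T -> I n)
    (c : forall n, I n -> B) (e : nat -> R) :
  (forall n i, measurable (p n @^-1` [set i])) ->
  (forall n x, D x -> bnorm (F x - c n (p n x)) <= e n) ->
  e @ \oo --> 0 -> bochner_integrable mu D F.
Proof.
move=> mp hc e0.
pose t n := c n \o p n.
have bt n : bsimple mu D (t n) by exact: bsimple_finType.
have ht n x : D x -> bnorm (F x - t n x) <= e n by exact: hc.
have hI n : (\int[mu]_(x in D) (bnorm (F x - t n x))%:E
             <= (e n * fine (mu D))%:E)%E.
  have -> : ((e n * fine (mu D))%:E = \int[mu]_(x in D) (e n)%:E)%E.
    by rewrite (integral_cst _ mD) EFinM fineK// ge0_fin_numE.
  apply: ge0_le_integral => //.
  - by move=> x _; rewrite lee_fin bnorm_ge0.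
  - by apply/measurable_EFinP; exact: measurable_dist_bsimple.
  - by move=> x Dx; rewrite lee_fin ht.
pose m := fine (mu D); have m0 : 0 <= m by exact: fine_ge0.
have em0 : (fun n => e n * m) @ \oo --> 0.
  by rewrite -[X in _ --> X](mul0r m); apply: cvgMl.
have hd n k : bnorm (bsimple_integral mu D (t n) - bsimple_integral mu D (t k))
    <= 3 * (e n * m) + 3 * (e k * m).
  pose S := \sum_i (fine (mu (D `&` p n @^-1` [set i])))%:C%C *: c n i.
  have hS j : bnorm (bsimple_integral mu D (t j) - S) <= e j * m + e n * m.
    rewrite -lee_fin EFinD; apply: le_trans (leeD (hI j) (lexx _)).
    exact: (bsimple_integral_riemann (bt j) (mp n) (hc n)).
  apply: le_trans (bnorm_triangle _ S _) _; rewrite [X in _ + X]bnormB.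
  have := hS n; have := hS k.
  have : 0 <= e k * m.
    rewrite -lee_fin; apply: le_trans (hI k); apply: integral_ge0 => x _.
    by rewrite lee_fin bnorm_ge0.
  lra.
have cv : cvg ((fun n => bsimple_integral mu D (t n)) @ \oo).
  apply/cauchy_cvgP/cauchy_exP => r; rewrite ltcE/= => /andP[/eqP imr r0].
  have r40 : 0 < complex.Re r / 6 by rewrite divr_gt0.
  have /cvgrPdist_lt/(_ _ r40) hn := em0.
  have [N _ hN] := hn.
  exists (bsimple_integral mu D (t N)); exists N => // n /= Nn.
  rewrite -ball_normE/= norm_bnorm ltcE/= imr eqxx/=.
  apply: le_lt_trans (hd N n) _.
  have := hN N (leqnn N); have := hN n Nn; rewrite /= !sub0r !normrN.
  move=> /(le_lt_trans (ler_norm _)) ? /(le_lt_trans (ler_norm _)) ?; lra.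
exists (lim ((fun n => bsimple_integral mu D (t n)) @ \oo)), t.
split; [exact: bt| | |exact: cv].
- apply: aeW => x Dx; apply/cvg_bnorm => r r0.
  have /cvgrPdist_lt/(_ _ r0) := e0; apply: filterS => n; rewrite sub0r normrN.
  move=> /(le_lt_trans (ler_norm _)); exact: le_lt_trans (ht n x Dx).
- apply: (@squeeze_cvge _ _ _ _ (cst 0%E) _ (fun n => (e n * m)%:E)).
  + near=> n; rewrite /= hI andbT; apply: integral_ge0 => x _.
    by rewrite lee_fin bnorm_ge0.
  + exact: cvg_cst.
  + by apply: cvg_EFin; [near=> n|exact: em0].
Unshelve. all: by end_near. Qed.

End bochner.
End partitions.

(** * Riemann sums on an interval *)

Section riemann.
Context (R : realType) (T : R) (n : nat).
Hypotheses (T0 : 0 < T) (n0 : (0 < n)%N).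
Local Notation lebesgue := (@lebesgue_measure R).

(** The index n is the null cell consisting of the right end point T. *)
Definition grid (x : R) : 'I_n.+1 := inord (Num.trunc (x * (n%:R / T))).

Definition node (i : nat) : R := i%:R * (T / n%:R).

Let nR : 0 < (n%:R : R). Proof. by rewrite ltr0n. Qed.

Let step0 : 0 < T / n%:R. Proof. exact: divr_gt0. Qed.

Lemma measurable_grid i : measurable (grid @^-1` [set i]).
Proof.
have ml k : measurable [set x : R | (Num.trunc (x * (n%:R / T)) <= k)%N].
  have -> : [set x : R | (Num.trunc (x * (n%:R / T)) <= k)%N] =
      `]-oo, (k.+1%:R / (n%:R / T))[%classic.
    apply/seteqP; split=> x /=; rewrite in_itv/= truncn_le_nat;
      by rewrite ltr_pdivlMr// divr_gt0.
  exact: measurable_itv.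
have me k : measurable [set x : R | Num.trunc (x * (n%:R / T)) = k].
  case: k => [|k].
    have -> : [set x : R | Num.trunc (x * (n%:R / T)) = 0%N] =
        [set x : R | (Num.trunc (x * (n%:R / T)) <= 0)%N].
      by apply/seteqP; split=> x /=; [move=> ->|rewrite leqn0 => /eqP].
    exact: ml.
  have -> : [set x : R | Num.trunc (x * (n%:R / T)) = k.+1] =
      [set x : R | (Num.trunc (x * (n%:R / T)) <= k.+1)%N] `\`
      [set x : R | (Num.trunc (x * (n%:R / T)) <= k)%N].
    apply/seteqP; split=> x /=; first by move=> ->; split=> //; lia.
    by move=> [? ?]; lia.
  exact: measurableD.
have -> : grid @^-1` [set i] =
    \bigcup_(k in [set k | inord k = i])
      [set x : R | Num.trunc (x * (n%:R / T)) = k].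
  apply/seteqP; split=> [x /= xi|x [k /= ki xk]]; last by rewrite /grid xk.
  by exists (Num.trunc (x * (n%:R / T))).
by apply: bigcup_measurable => k _; exact: me.
Qed.

Lemma gridP x : 0 <= x <= T -> node (grid x) <= x < node (grid x).+1.
Proof.
move=> /andP[x0 xT]; have y0 : 0 <= x * (n%:R / T) by rewrite mulr_ge0// divr_ge0// ltW.
have gE : grid x = Num.trunc (x * (n%:R / T)) :> nat.
  rewrite inordK// ltnS -(ler_nat R).
  have /andP[h _] := truncn_itv y0; apply: le_trans h _.
  by rewrite mulrA ler_pdivrMr// mulrC ler_wpM2l// ltW.
have := truncn_itv y0; rewrite -gE /node => /andP[h1 h2].
have hx : x = x * (n%:R / T) * (T / n%:R).
  by field; rewrite !gt_eqF.
by rewrite {2 3}hx ler_pM2r// ltr_pM2r// h1 h2.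
Qed.

Lemma node01 i : (i <= n)%N -> 0 <= node i <= T.
Proof.
move=> iN; rewrite /node mulr_ge0 ?(ltW step0)//=.
by rewrite mulrA ler_pdivrMr// mulrC ler_wpM2l ?(ltW T0)// ler_nat.
Qed.

Lemma nodeS i : node i.+1 = node i + T / n%:R.
Proof. by rewrite /node -natr1 mulrDl mul1r. Qed.

Lemma node_le i j : (i <= j)%N -> node i <= node j.
Proof. by move=> ij; rewrite /node ler_pM2r// ler_nat. Qed.

Lemma node_max : node n = T.
Proof. by rewrite /node mulrC divfK// gt_eqF. Qed.

Lemma grid_dist x : 0 <= x <= T -> `|x - node (grid x)| <= T / n%:R.
Proof.
move=> /gridP; rewrite nodeS => /andP[h1 h2].
by rewrite ger0_norm ?subr_ge0//; lra.
Qed.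

Lemma grid_measure (i : 'I_n.+1) :
  fine (lebesgue ([set` `[0, T]] `&` grid @^-1` [set i])) =
  if (i < n)%N then T / n%:R else 0.
Proof.
have cell x j : 0 <= x <= T -> node j <= x < node j.+1 -> grid x = j :> nat.
  move=> x0T /andP[h1 h2]; have /andP[h3 h4] := gridP x0T.
  have [/node_le h5|/node_le h5|//] := ltngtP (grid x) j.
    by have := lt_le_trans h4 h5; rewrite ltNge h1.
  by have := lt_le_trans h2 h5; rewrite ltNge h3.
case: ifPn => [iN|]; last rewrite -leqNgt => iN.
  have -> : `[0, T] `&` grid @^-1` [set i] = `[node i, node i.+1[%classic.
    apply/seteqP; split=> x /=; rewrite !in_itv/=.
      by move=> [x0T <-]; exact: gridP.
    move=> h; have x0T : 0 <= x <= T.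
      have /andP[i0 _] := node01 (ltnW iN); have /andP[_ i1] := node01 iN.
      by move/andP: h => [? ?]; apply/andP; split; lra.
    by split=> //; apply/val_inj; exact: cell.
  rewrite lebesgue_measure_itv/= lte_fin nodeS ltrDl step0 /=.
  by rewrite addrC addKr.
have iE : i = n :> nat by apply/eqP; rewrite eqn_leq iN -ltnS ltn_ord.
have -> : `[0, T] `&` grid @^-1` [set i] = [set T].
  apply/seteqP; split=> x /=; rewrite in_itv/=.
    by move=> [x0T gx]; have := gridP x0T; rewrite gx iE node_max; lra.
  move=> ->; have T0T : 0 <= T <= T by rewrite lexx ltW.
  split=> //; apply/val_inj; apply: cell => //.
  by rewrite /= iE nodeS node_max lexx ltrDl.
by rewrite lebesgue_measure_set1.
Qed.

Lemma measurable_step (c : nat -> R) :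
  measurable_fun `[0, T] (fun x => c (grid x)).
Proof.
move=> _ Y mY.
have -> : (fun x => c (grid x)) @^-1` Y =
    \bigcup_(i in [set i : 'I_n.+1 | Y (c i)]) (grid @^-1` [set i]).
  by apply/seteqP; split=> [x /= Yx|x [i Yi /= ->]]//; exists (grid x).
apply: measurableI; first exact: measurable_itv.
apply: fin_bigcup_measurable => [|i _]; first exact: finite_finset.
exact: measurable_grid.
Qed.

Lemma integral_step (c : nat -> R) : (forall i, (i <= n)%N -> 0 <= c i) ->
  (\int[lebesgue]_(x in `[0%R, T]) (c (grid x))%:E =
   (T / n%:R * \sum_(i < n) c i)%:E)%E.
Proof.
move=> c0; have cg0 x : 0 <= c (grid x) by apply: c0; rewrite -ltnS.
rewrite (@integral_preimages _ _ R lebesgue [set` `[0%R, T]] _ grid (enum 'I_n.+1)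
  (fun x => (c (grid x))%:E))//; last first.
- by move=> x _; rewrite lee_fin.
- by apply/measurable_EFinP; exact: measurable_step.
- exact: measurable_grid.
- by move=> x _; rewrite mem_enum.
- exact: enum_uniq.
transitivity (\sum_i (fine (lebesgue ([set` `[0%R, T]] `&` grid @^-1` [set i]))
                      * c i)%:E)%E.
  rewrite big_enum/=; apply: eq_bigr => i _.
  have mi : measurable ([set` `[0, T]] `&` grid @^-1` [set i]).
    by apply: measurableI; [exact: measurable_itv|exact: measurable_grid].
  transitivity (\int[lebesgue]_(x in [set` `[0%R, T]] `&` grid @^-1` [set i])
      (c i)%:E)%E.
    by apply: eq_integral => x; rewrite inE => -[_ /= ->].
  rewrite (@integral_cst _ _ R lebesgue _ mi) mulrC EFinM fineK// ge0_fin_numE//.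
  apply: (@le_lt_trans _ _ (lebesgue [set` `[0%R, T]])).
    by apply: le_measure; rewrite ?inE//; exact: measurable_itv.
  by rewrite lebesgue_measure_itv/= lte_fin T0 sube0 ltry.
rewrite sumEFin; congr (_%:E); rewrite big_ord_recr/= grid_measure ltnn mul0r addr0.
rewrite mulr_sumr; apply: eq_bigr => i _; by rewrite grid_measure/= ltn_ord.
Qed.

Section lipschitz.
Context (B : completeNormedModType R[i]) (F : R -> B) (L : R).
Hypothesis FL : forall x y, 0 <= x <= T -> 0 <= y <= T ->
  bnorm (F x - F y) <= L * `|x - y|.

Lemma grid_sum (c : nat -> B) :
  \sum_i (fine (lebesgue ([set` `[0, T]] `&` grid @^-1` [set i])))%:C%C *: c i =
  (T / n%:R)%:C%C *: \sum_(i < n) c i.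
Proof.
under eq_bigr do rewrite grid_measure.
rewrite big_ord_recr/= ltnn scale0r addr0 scaler_sumr.
by apply: eq_bigr => i _; rewrite ltn_ord.
Qed.

Lemma lipschitz_ge0 : 0 <= L.
Proof.
have a : 0 <= (0 : R) <= T by rewrite lexx ltW.
have b : 0 <= T <= T by rewrite lexx ltW.
have := le_trans (bnorm_ge0 _) (FL a b).
by rewrite sub0r normrN gtr0_norm// pmulr_lge0.
Qed.

Lemma lipschitz_measurable b :
  measurable_fun `[0, T] (fun x => bnorm (F x - b)).
Proof.
apply: subspace_continuous_measurable_fun; first exact: measurable_itv.
apply/subspace_continuousP => x; rewrite /= in_itv/= => x0T.
apply/cvgrPdist_lt => e e0.
have L1 : 0 < L + 1 by rewrite ltr_wpDl ?lipschitz_ge0.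
rewrite near_withinE; apply/nbhs_ballP; exists (e / (L + 1)).
  exact: divr_gt0.
move=> y; rewrite /ball/= ltr_pdivlMr// => xy; rewrite in_itv/= => y0T.
apply: le_lt_trans (bnorm_dist _ _) _; rewrite opprB addrA subrK.
apply: le_lt_trans (FL x0T y0T) _; apply: le_lt_trans xy.
by rewrite mulrC ler_wpM2l// lerDl.
Qed.

Lemma lipschitz_grid x : 0 <= x <= T ->
  bnorm (F x - F (node (grid x))) <= L * (T / n%:R).
Proof.
move=> x0T; apply: le_trans (FL x0T _) _; first by apply: node01; rewrite -ltnS.
by rewrite ler_wpM2l ?lipschitz_ge0// grid_dist.
Qed.

End lipschitz.
End riemann.

Section lipschitz_bochner.
Context (R : realType) (T : R) (B : completeNormedModType R[i]).
Variables (F : R -> B) (L : R).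
Hypothesis T0 : 0 < T.
Hypothesis FL : forall x y, 0 <= x <= T -> 0 <= y <= T ->
  bnorm (F x - F y) <= L * `|x - y|.
Local Notation lebesgue := (@lebesgue_measure R).

Let lebesgueT : lebesgue [set` `[0, T]] = T%:E.
Proof. by rewrite lebesgue_measure_itv/= lte_fin T0 sube0. Qed.

Let finT : (lebesgue [set` `[0%R, T]] < +oo)%E.
Proof. by rewrite lebesgueT ltry. Qed.

Lemma lipschitz_riemann n v : (0 < n)%N -> is_bochner_integral lebesgue [set` `[0, T]] F v ->
  bnorm (v - (T / n%:R)%:C%C *: \sum_(i < n) F (node T n i))
    <= L * (T / n%:R) * T.
Proof.
move=> n0 hv; rewrite -(grid_sum T0 n0 (fun i => F (node T n i))).
have -> : L * (T / n%:R) * T = L * (T / n%:R) * fine (lebesgue [set` `[0, T]]).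
  by rewrite lebesgueT.
apply: (@bochner_riemann _ _ R lebesgue B [set` `[0, T]] (measurable_itv _) finT F
  (lipschitz_measurable T0 FL) _ (grid T n) (fun i => F (node T n i)) _ v hv).
- by move=> i; exact: measurable_grid.
- by move=> x; rewrite /= in_itv/=; exact: lipschitz_grid.
Qed.

Lemma lipschitz_bochner_integrable : bochner_integrable lebesgue [set` `[0, T]] F.
Proof.
apply: (@bochner_integrable_riemann _ _ R lebesgue B [set` `[0, T]]
  (measurable_itv _) finT F (lipschitz_measurable T0 FL) (fun n => 'I_n.+2)
  (fun n => grid T n.+1) (fun n i => F (node T n.+1 i))
  (fun n => L * (T / n.+1%:R))).
- by move=> n i; exact: measurable_grid.
- by move=> n x; rewrite /= in_itv/=; exact: lipschitz_grid.
have -> : (fun n => L * (T / n.+1%:R)) = (fun n => (L * T) * n.+1%:R^-1).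
  by apply/funext => n; rewrite mulrA.
rewrite -(mulr0 (L * T)); apply: cvgMr; exact: cvg_harmonic.
Qed.

End lipschitz_bochner.

(** The step function through the samples is within L / n of the weight, whose
    integral is 1. *)
Lemma weight_total_cvg (R : realType) (m : nat) (w : R -> R) (L : R) (n : nat) :
  weighting_function m w -> 0 <= L ->
  (forall x y, 0 <= x <= 1 -> 0 <= y <= 1 -> `|w x - w y| <= L * `|x - y|) ->
  (0 < n)%N -> `|weight_total w n / n%:R - 1| <= L / n%:R.
Proof.
move=> hw L0 wL n0.
have wge x : 0 <= x <= 1 -> 0 <= w x by exact: (weight_ge0 hw).
have [hs _ _ w1] := hw.
pose D := [set` `[(0 : R), 1]]; have mD : measurable D by exact: measurable_itv.
have DE x : D x -> 0 <= x <= 1 by rewrite /D/= in_itv.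
have lD : lebesgue_measure D = 1%E.
  by rewrite /D lebesgue_measure_itv/= lte_fin ltr01 sube0.
pose e := L / n%:R; have e0 : 0 <= e by rewrite divr_ge0.
have mw : measurable_fun D w.
  apply: subspace_continuous_measurable_fun => //.
  exact: within_continuous01 (hs 0%N).
have nE i : node (1 : R) n i = i%:R / n%:R by rewrite /node mul1r.
have n01 i : (i <= n)%N -> 0 <= node (1 : R) n i <= 1 by exact: (node01 ltr01 n0).
have near x : D x -> `|w x - w (node (1 : R) n (grid (1 : R) n x))| <= e.
  move=> /DE x01; apply: le_trans (wL _ _ x01 _) _.
    by apply: n01; rewrite -ltnS.
  rewrite ler_wpM2l//; have := grid_dist ltr01 n0 x01.
  by rewrite mul1r.
have g01 x : (grid (1 : R) n x <= n)%N by rewrite -ltnS.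
have tot : weight_total w n / n%:R = 1 / n%:R * \sum_(i < n) w (node (1 : R) n i).
  rewrite /weight_total mulrC mul1r; congr (_ * _).
  by apply: eq_bigr => i _; rewrite nE.
have up : 1 <= weight_total w n / n%:R + e.
  have <- : 1 / n%:R * \sum_(i < n) (w (node (1 : R) n i) + e) =
      weight_total w n / n%:R + e.
    rewrite big_split/= sumr_const card_ord mulrDr -tot; congr (_ + _).
    by rewrite -[e *+ n]mulr_natr mulrCA mul1r mulVf ?mulr1// pnatr_eq0 -lt0n.
  rewrite -lee_fin -w1 -(@integral_step _ 1 n ltr01 n0 (fun i => w (node (1 : R) n i) + e)).
    apply: ge0_le_integral => //.
    - exact/measurable_EFinP.
    - apply/measurable_EFinP.
      exact: (measurable_step ltr01 n0 (fun i => w (node (1 : R) n i) + e)).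
    - by move=> x /near; rewrite lee_fin ler_norml; lra.
  by move=> i /n01/wge h; rewrite addr_ge0.
have down : weight_total w n / n%:R <= 1 + e.
  rewrite tot -lee_fin.
  rewrite -(@integral_step _ 1 n ltr01 n0 (fun i => w (node (1 : R) n i))); last first.
    by move=> i /n01/wge.
  have -> : ((1 + e)%:E = \int[lebesgue_measure]_(x in D) (w x + e)%:E)%E.
    under eq_integral do rewrite EFinD.
    rewrite ge0_integralD//.
    - rewrite w1 (@integral_cst _ _ R lebesgue_measure _ mD) EFinD.
      by rewrite -[X in (_ + X)%E = _]mule1; congr (_ + _ * _)%E; exact/esym.
    - exact/measurable_EFinP.
  apply: ge0_le_integral => //.
  - by move=> x _; rewrite lee_fin; exact/wge/n01.
  - apply/measurable_EFinP.
    exact: (measurable_step ltr01 n0 (fun i => w (node (1 : R) n i))).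
  - by apply/measurable_EFinP; apply: measurable_funD.
  - by move=> x /near; rewrite lee_fin ler_norml; lra.
by rewrite ler_norml; apply/andP; split; move: up down; rewrite -/e; lra.
Qed.

(** * Weighted averages along orbits *)

(** The constants S, M, L, W and c come before rho and theta, which makes the
    final bounds uniform in both. *)
Section averages.
Context (R : realType) (B : completeNormedModType R[i]).
Variables (vol : probability (torus R) R) (eta : nat) (mu gamma : R).
Variables (f : torus R -> B) (m : nat) (w : R -> R) (S M L W c : R).
Hypotheses (mu1 : 1 < mu) (gamma0 : 0 < gamma) (m2 : (2 <= m)%N).
Hypothesis hw : weighting_function m w.
Hypotheses (S0 : 0 <= S) (M0 : 0 <= M) (L0 : 0 <= L) (W0 : 0 <= W) (c0 : 0 < c).
Let mean := bochner_integral vol setT f.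
Hypothesis combination : forall (I : finType) (a : I -> R[i])
    (theta : I -> torus R) (K : R), 0 <= K ->
    (forall k, Zstar R eta k -> k <> (fun=> 0) ->
       Normc.normc (\sum_i a i * character k (theta i))
         <= K * dioph_prod mu k ^+ m) ->
    bnorm (\sum_i a i *: f (theta i) - (\sum_i a i) *: mean) <= K * S.
Hypothesis exp_sum : forall N (z : R[i]), (0 < N)%N -> Normc.normc z = 1 ->
  Normc.normc (1 - z) ^+ m *
    Normc.normc (\sum_(n < N) (w (n%:R / N%:R))%:C%C * z ^+ n)
  <= M * N%:R / N%:R ^+ m.
Hypothesis wL : forall x y, 0 <= x <= 1 -> 0 <= y <= 1 ->
  `|w x - w y| <= L * `|x - y|.
Hypothesis wW : forall x, 0 <= x <= 1 -> `|w x| <= W.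
Hypothesis total_ge : forall N, (2 <= N)%N -> c * N%:R <= weight_total w N.
Variables (rho : nat -> R) (theta : torus R).
Hypothesis rho12 : forall j, 1 <= rho j <= 2.
Hypothesis dioph : diophantine eta gamma mu rho.

Let prod_ge1 k : Zstar R eta k -> 1 <= dioph_prod mu k.
Proof. exact: dioph_prod_ge1. Qed.

Lemma exp_sum_le N (z : R[i]) d : (0 < N)%N -> Normc.normc z = 1 -> 0 < d ->
  d <= Normc.normc (1 - z) ->
  Normc.normc (\sum_(n < N) (w (n%:R / N%:R))%:C%C * z ^+ n)
    <= M * N%:R / (N%:R * d) ^+ m.
Proof.
move=> N0 z1 d0 dz; have NR : 0 < (N%:R : R) by rewrite ltr0n.
rewrite exprMn invfM mulrA ler_pdivlMr ?exprn_gt0// mulrC.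
apply: le_trans (exp_sum N0 z1); rewrite ler_wpM2r ?normc_ge0//.
by apply: lerXn2r; rewrite ?nnegrE ?normc_ge0// ltW.
Qed.

(** By the Diophantine condition gamma over the Diophantine product is a lower
    bound for the chord from 1 to the ratio z of the k-th character. *)
Lemma WB_close N : (2 <= N)%N ->
  bnorm (WB w rho f N theta - mean) <= M / (c * gamma ^+ m) * S / N%:R ^+ m.
Proof.
move=> N2; have N0 : (0 < N)%N by exact: leq_trans N2.
have NR : 0 < (N%:R : R) by rewrite ltr0n.
pose A := weight_total w N; have cA : c * N%:R <= A by exact: total_ge.
have A0 : 0 < A by apply: lt_le_trans cA; rewrite mulr_gt0.
pose a (n : 'I_N) : R[i] := (A^-1)%:C%C * (w (n%:R / N%:R))%:C%C.
have suma : \sum_n a n = 1.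
  rewrite -mulr_sumr -(raddf_sum (real_complex R)) -rmorphM/=.
  by rewrite -[\sum_(n < N) _]/A mulVf ?gt_eqF.
have -> : WB w rho f N theta - mean =
    \sum_n a n *: f (iter n (rotation rho) theta) - (\sum_n a n) *: mean.
  rewrite suma scale1r /WB scaler_sumr; congr (_ - _).
  by apply: eq_bigr => n _; rewrite scalerA.
pose K := M / (c * gamma ^+ m) / N%:R ^+ m.
have -> : M / (c * gamma ^+ m) * S / N%:R ^+ m = K * S by rewrite /K mulrAC.
apply: (@combination _ a (fun n : 'I_N => iter n (rotation rho) theta)).
  by rewrite !divr_ge0 ?mulr_ge0 ?exprn_ge0// ltW.
move=> k kZ kn0; have p1 := prod_ge1 kZ.
have p0 : 0 < dioph_prod mu k by rewrite (lt_le_trans ltr01).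
pose z : R[i] := cis (kdot k rho).
have -> : \sum_n a n * character k (iter n (rotation rho) theta) =
    character k theta * (A^-1)%:C%C *
      \sum_(n < N) (w (n%:R / N%:R))%:C%C * z ^+ n.
  rewrite mulr_sumr; apply: eq_bigr => n _.
  by rewrite (character_rotation _ _ _ kZ) /a; ring.
rewrite !Normc.normcM normc_character mul1r normc_real gtr0_norm ?invr_gt0//.
have d0 : 0 < gamma / dioph_prod mu k by rewrite divr_gt0.
have dz : gamma / dioph_prod mu k <= Normc.normc (1 - z).
  by apply: chord_ge => n; apply/ltW/dioph.
apply: le_trans (ler_wpM2l _ (exp_sum_le N0 (normc_cis _) d0 dz)) _.
  by rewrite invr_ge0 ltW.
apply: (@le_trans _ _ ((c * N%:R)^-1 *
    (M * N%:R / (N%:R * (gamma / dioph_prod mu k)) ^+ m))).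
  apply: ler_wpM2r; last by rewrite lef_pV2 ?posrE ?mulr_gt0.
  apply: divr_ge0; first exact: mulr_ge0.
  by rewrite exprn_ge0// mulr_ge0// ltW.
rewrite /K !exprMn exprVn le_eqVlt; apply/orP; left; apply/eqP.
by field; rewrite !expf_neq0 ?gt_eqF.
Qed.

Section flow.
Variable T : R.
Hypothesis T1 : 1 <= T.

Let T0 : 0 < T. Proof. exact: lt_le_trans T1. Qed.

Let Fl := flow_integrand w rho f T theta.

Let div01 x : 0 <= x <= T -> 0 <= x / T <= 1.
Proof.
by move=> /andP[x0 xT]; rewrite divr_ge0 ?(ltW T0)//= ler_pdivrMr// mul1r.
Qed.

(** An increment is a combination of two values of f. The k-th phase turns at a
    speed proportional to |k.rho|, which a single factor of the Diophantine
    product absorbs; the mean of f contributes the increment of the weight. *)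
Lemma flow_integrand_lipschitz x y : 0 <= x <= T -> 0 <= y <= T ->
  bnorm (Fl x - Fl y) <=
    ((L + 8 * pi * W) * S + L * bnorm mean) * `|x - y|.
Proof.
move=> x0T y0T.
pose a (b : bool) : R[i] := if b then (w (x / T))%:C%C else (- w (y / T))%:C%C.
pose th (b : bool) := flow rho (if b then x else y) theta.
have hxy : `|w (x / T) - w (y / T)| <= L * `|x - y|.
  apply: le_trans (wL (div01 x0T) (div01 y0T)) _.
  rewrite ler_wpM2l// -mulrBl normrM ler_piMr// ger0_norm ?invr_ge0 ?(ltW T0)//.
  by rewrite invf_le1.
have -> : Fl x - Fl y = (\sum_b a b *: f (th b) - (\sum_b a b) *: mean) +
    (w (x / T) - w (y / T))%:C%C *: mean.
  rewrite !big_bool /= /Fl /flow_integrand -rmorphD/= addrAC -addrA subrr addr0.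
  by rewrite rmorphN scaleNr.
apply: le_trans (bnormD _ _) _.
have -> : ((L + 8 * pi * W) * S + L * bnorm mean) * `|x - y| =
    (L + 8 * pi * W) * `|x - y| * S + L * `|x - y| * bnorm mean by ring.
have pW : 0 <= 8 * pi * W by rewrite !mulr_ge0 ?pi_ge0.
apply: lerD; last by rewrite bnormZ normc_real ler_wpM2r ?bnorm_ge0.
apply: combination => [|k kZ kn0]; first by rewrite mulr_ge0// addr_ge0.
have p1 := prod_ge1 kZ; have p0 : 0 < dioph_prod mu k by rewrite (lt_le_trans ltr01).
pose chi := character k theta; pose b := kdot k rho.
have -> : \sum_j a j * character k (th j) =
    chi * ((w (x / T) - w (y / T))%:C%C * cis (b * x) +
           (w (y / T))%:C%C * (cis (b * x) - cis (b * y))).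
  rewrite big_bool /a /th !(character_flow _ _ _ kZ) rmorphN rmorphB /= -/chi -/b.
  by ring.
rewrite Normc.normcM normc_character mul1r; apply: le_trans (normcD _ _) _.
rewrite !Normc.normcM normc_cis mulr1 !normc_real.
apply: (@le_trans _ _ (L * `|x - y| + W * (8 * pi * dioph_prod mu k * `|x - y|))).
  apply: lerD => //; apply: ler_pM; rewrite ?normc_ge0 ?wW ?div01//.
  apply: le_trans (cis_lipschitz _ _) _.
  rewrite -mulrBr normrM mulrA ler_wpM2r//.
  have -> : 8 * pi * dioph_prod mu k = 4 * pi * (2 * dioph_prod mu k) by ring.
  rewrite ler_wpM2l ?mulr_ge0 ?pi_ge0//; exact: kdot_le kZ rho12.
have -> : L * `|x - y| + W * (8 * pi * dioph_prod mu k * `|x - y|) =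
    (L + 8 * pi * W * dioph_prod mu k) * `|x - y| by ring.
rewrite [leRHS]mulrAC ler_wpM2r//.
have pm : dioph_prod mu k <= dioph_prod mu k ^+ m.
  by apply: ler_eXnr => //; exact: leq_trans m2.
rewrite [leRHS]mulrDl; apply: lerD; last by rewrite ler_wpM2l.
by rewrite ler_peMr// (le_trans p1).
Qed.

(** When the angle b T / n is at most 1/2, it is dominated by its chord, and the
    powers of n cancel; otherwise the frequency is so large that the Diophantine
    product alone provides the decay. *)
Lemma flow_node_sum n (k : nat -> int) : T ^+ 2 <= n%:R ->
  Zstar R eta k -> k <> (fun=> 0) ->
  Normc.normc (\sum_(i < n) (n%:R^-1 * w (i%:R / n%:R))%:C%C *
                 character k (flow rho (node T n i) theta))
  <= (M / gamma ^+ m + W * 4 ^+ m) / T ^+ m * dioph_prod mu k ^+ m.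
Proof.
move=> Tn kZ kn0.
have nR : 0 < (n%:R : R) by apply: lt_le_trans Tn; rewrite exprn_gt0.
have n0 : (0 < n)%N by rewrite -(ltr0n R).
have p1 := prod_ge1 kZ; have p0 : 0 < dioph_prod mu k by rewrite (lt_le_trans ltr01).
set p := dioph_prod mu k in p1 p0 *.
pose b := kdot k rho; pose z : R[i] := cis (b * (T / n%:R)).
have bp : `|b| <= 2 * p by exact: kdot_le kZ rho12.
have bg : gamma / p <= `|b|.
  by have := dioph 0 kZ kn0; rewrite subr0 => /ltW.
have b0 : 0 < `|b| by apply: lt_le_trans bg; rewrite divr_gt0.
have -> : \sum_(i < n) (n%:R^-1 * w (i%:R / n%:R))%:C%C *
      character k (flow rho (node T n i) theta) =
    character k theta * (n%:R^-1)%:C%C *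
      \sum_(i < n) (w (i%:R / n%:R))%:C%C * z ^+ i.
  rewrite mulr_sumr; apply: eq_bigr => i _; rewrite (character_flow _ _ _ kZ).
  have -> : kdot k rho * node T n i = (b * (T / n%:R)) *+ i.
    by rewrite /node -mulr_natr /b; ring.
  by rewrite cis_mulrn rmorphM -/z; ring.
rewrite !Normc.normcM normc_character mul1r normc_real gtr0_norm ?invr_gt0//.
have Tm0 : 0 < T ^+ m by rewrite exprn_gt0.
have q1 : 0 <= M / gamma ^+ m / T ^+ m * p ^+ m.
  by rewrite mulr_ge0 ?divr_ge0 ?exprn_ge0 ?(ltW gamma0) ?(ltW T0) ?(ltW p0).
have q2 : 0 <= W * 4 ^+ m / T ^+ m * p ^+ m.
  by rewrite mulr_ge0 ?divr_ge0 ?mulr_ge0 ?exprn_ge0 ?(ltW T0) ?(ltW p0).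
rewrite 2!mulrDl.
have [small|large] := leP (`|b| * (T / n%:R)) (1 / 2).
  apply: ler_wpDr => //.
  pose d := `|b| * (T / n%:R).
  have d0 : 0 < d by rewrite mulr_gt0// divr_gt0.
  have dE : `|b * (T / n%:R)| = d by rewrite normrM (gtr0_norm (divr_gt0 T0 nR)).
  have dz : d <= Normc.normc (1 - z).
    by rewrite -dE; apply: le_normc_1_sub_cis; rewrite dE.
  apply: le_trans (ler_wpM2l _ (exp_sum_le n0 (normc_cis _) d0 dz)) _.
    by rewrite invr_ge0 ltW.
  have -> : n%:R * d = `|b| * T by rewrite /d; field; rewrite gt_eqF.
  have -> : n%:R^-1 * (M * n%:R / (`|b| * T) ^+ m) = M / (`|b| * T) ^+ m.
    by field; rewrite expf_neq0 ?mulf_neq0 ?gt_eqF.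
  have -> : M / gamma ^+ m / T ^+ m * p ^+ m = M / (gamma / p * T) ^+ m.
    by rewrite !exprMn exprVn; field; rewrite !expf_neq0 ?gt_eqF.
  rewrite ler_wpM2l// lef_pV2 ?posrE ?exprn_gt0 ?mulr_gt0 ?invr_gt0//.
  apply: lerXn2r; rewrite ?nnegrE ?mulr_ge0 ?invr_ge0 ?(ltW gamma0) ?(ltW p0)
    ?(ltW T0)//.
  by rewrite ler_wpM2r// ltW.
apply: ler_wpDl => //.
have hW : n%:R^-1 * Normc.normc (\sum_(i < n) (w (i%:R / n%:R))%:C%C * z ^+ i) <= W.
  rewrite mulrC ler_pdivrMr//; apply: le_trans (normc_sum _ _ _) _.
  apply: le_trans (ler_sum (G := fun=> W) _ _) _ => [i _|].
    rewrite Normc.normcM normcX normc_cis expr1n mulr1 normc_real wW//.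
    by rewrite divr_ge0//= ler_pdivrMr// mul1r ler_nat ltnW.
  by rewrite sumr_const card_ord mulr_natr.
apply: le_trans hW _.
have -> : W * 4 ^+ m / T ^+ m * p ^+ m = W * (4 * p / T) ^+ m.
  by rewrite !exprMn exprVn; ring.
rewrite ler_peMr// exprn_ege1// ler_pdivlMr// mul1r.
(* 1 < 2 |b| T / n <= 4 p T / n and T ^ 2 <= n *)
move: large; rewrite mulrA ltr_pdivlMr// => large.
rewrite -(ler_pM2r T0); move: Tn large; rewrite expr2 => Tn large.
have : `|b| * T <= 2 * p * T by rewrite ler_wpM2r// ltW.
lra.
Qed.

(** The distance from the integral to its Riemann sums and the one from the mean
    of the samples of w to 1 are O(1 / n), whereas the Riemann sums are close to
    the mean of f uniformly in n >= T^2. *)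
Lemma WB_flow_close v :
  is_bochner_integral (@lebesgue_measure R) `[0, T] Fl v ->
  bnorm ((T^-1)%:C%C *: v - mean)
    <= (M / gamma ^+ m + W * 4 ^+ m) * S / T ^+ m.
Proof.
move=> hv; apply/ler_addgt0Pr => e e0.
pose Lf := (L + 8 * pi * W) * S + L * bnorm mean.
have Lf0 : 0 <= Lf.
  by rewrite addr_ge0// mulr_ge0 ?bnorm_ge0// addr_ge0// !mulr_ge0 ?pi_ge0.
pose Q := Lf * T + L * bnorm mean.
have Q0 : 0 <= Q by rewrite addr_ge0 ?mulr_ge0 ?bnorm_ge0 ?(ltW T0).
(* Q / n bounds the sum of the two discretisation errors *)
pose n := (Num.trunc (T ^+ 2 + Q / e)).+1.
have nQ : T ^+ 2 + Q / e < n%:R by exact: truncnS_gt.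
have qe : 0 <= Q / e by rewrite divr_ge0// ltW.
have nR : 0 < (n%:R : R) by rewrite ltr0n.
have Tn : T ^+ 2 <= n%:R by lra.
have Qn : Q / n%:R <= e.
  rewrite ler_pdivrMr// mulrC -ler_pdivrMr//; have := sqr_ge0 T; lra.
have n0 : (0 < n)%N by [].
have h1 := lipschitz_riemann T0 flow_integrand_lipschitz n0 hv.
rewrite -/Lf in h1.
pose a (i : 'I_n) : R[i] := (n%:R^-1 * w (i%:R / n%:R))%:C%C.
pose th (i : 'I_n) := flow rho (node T n i) theta.
pose K := (M / gamma ^+ m + W * 4 ^+ m) / T ^+ m.
have K0 : 0 <= K.
  rewrite /K divr_ge0 ?exprn_ge0 ?(ltW T0)// addr_ge0 ?divr_ge0 ?mulr_ge0//.
  by rewrite exprn_ge0// ltW.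
have h2 : bnorm (\sum_i a i *: f (th i) - (\sum_i a i) *: mean) <= K * S.
  by apply: combination => // k kZ kn0; exact: flow_node_sum.
have suma : \sum_i a i = (weight_total w n / n%:R)%:C%C.
  by rewrite /a -(raddf_sum (real_complex R)) -mulr_sumr mulrC.
have sumf : \sum_i a i *: f (th i) =
    (T^-1)%:C%C *: ((T / n%:R)%:C%C *: \sum_(i < n) Fl (node T n i)).
  rewrite scalerA -rmorphM/= scaler_sumr; apply: eq_bigr => i _.
  rewrite /Fl /flow_integrand scalerA -rmorphM/= /a; congr (_%:C%C *: _).
  have -> : node T n i / T = i%:R / n%:R.
    by rewrite /node; field; rewrite !gt_eqF.
  by rewrite mulrA mulVf ?mul1r// gt_eqF.
have h3 := weight_total_cvg hw L0 wL n0.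
pose s := \sum_i a i *: f (th i).
have e1 : bnorm ((T^-1)%:C%C *: v - s) <= Lf * T / n%:R.
  rewrite /s sumf -scalerBr bnormZ normc_real gtr0_norm ?invr_gt0//.
  rewrite ler_pdivrMl//; apply: le_trans h1 _.
  by rewrite le_eqVlt; apply/orP; left; apply/eqP; ring.
have e2 : bnorm ((\sum_i a i) *: mean - mean) <= L * bnorm mean / n%:R.
  rewrite -[X in _ - X]scale1r -scalerBl suma -(rmorph1 (real_complex R)).
  rewrite -rmorphB/= bnormZ normc_real mulrAC ler_wpM2r ?bnorm_ge0//.
have -> : (M / gamma ^+ m + W * 4 ^+ m) * S / T ^+ m = K * S.
  by rewrite /K mulrAC.
apply: le_trans (bnorm_triangle _ s _) _.
apply: le_trans (lerD (lexx _) (bnorm_triangle _ ((\sum_i a i) *: mean) _)) _.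
have QE : Q / n%:R = Lf * T / n%:R + L * bnorm mean / n%:R by rewrite -mulrDl.
move: e1 e2 h2 Qn; rewrite -/s QE; lra.
Qed.

End flow.
End averages.

Theorem corollary2p11 (R : realType) (B : completeNormedModType R[i])
    (vol : probability (torus R) R) (hvol : is_product_measure vol)
    (eta : nat) (heta : (2 <= eta)%N)
    (mu gamma : R) (hmu : 1 < mu) (hgamma : 0 < gamma)
    (Delta : R -> R) (hDelta : approximation_function Delta)
    (f : torus R -> B) (hf : in_BDelta vol eta Delta f)
    (hana : analytic_torus vol eta f)
    (m : nat) (hm : (2 <= m)%N)
    (w : R -> R) (hw : weighting_function m w) :
  exists2 C3 : R, 0 < C3 &
    forall rho : nat -> R,
      (forall j, 1 <= rho j <= 2) ->
      diophantine eta gamma mu rho ->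
      forall theta : torus R,
        (forall N : nat, (2 <= N)%N ->
           bnorm (WB w rho f N theta - bochner_integral vol setT f)
             <= C3 / N%:R ^+ m) /\
        (forall T : R, 1 <= T ->
           bochner_integrable (@lebesgue_measure R) `[0, T]
             (flow_integrand w rho f T theta) /\
           bnorm (WB_flow w rho f T theta - bochner_integral vol setT f)
             <= C3 / T ^+ m).
Proof.
have [hint hser _] := hf.
have eta0 : (0 < eta)%N by apply: leq_trans heta.
have [S S0 hS] := analytic_combination m eta0 hmu hser hana.
have [M M0 hM] := weight_exp_sum hw.
have [L L0 hL] := weight_lipschitz hw (ltnW hm).
have [W W0 hW] := weight_max hw.
have [c c0 hc] := weight_total_ge hw.
pose C1 := M / (c * gamma ^+ m) * S.
pose C2 := (M / gamma ^+ m + W * 4 ^+ m) * S.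
have C10 : 0 <= C1.
  by rewrite mulr_ge0 ?divr_ge0 ?mulr_ge0 ?exprn_ge0 ?(ltW c0) ?(ltW hgamma).
have C20 : 0 <= C2.
  by rewrite mulr_ge0 ?addr_ge0 ?divr_ge0 ?mulr_ge0 ?exprn_ge0 ?(ltW hgamma).
exists (C1 + C2 + 1) => [|rho rho12 hrho theta]; first by rewrite ltr_wpDl ?addr_ge0.
split=> [N N2|T T1].
  have N0 : 0 < (N%:R : R) by rewrite ltr0n (leq_trans _ N2).
  have close := WB_close hmu hgamma M0 c0 hS hM hc theta hrho N2.
  apply: le_trans close _.
  rewrite -/C1 ler_wpM2r ?invr_ge0 ?exprn_ge0 ?(ltW N0)//.
  by rewrite -addrA lerDl addr_ge0.
have T0 : 0 < T by apply: lt_le_trans T1.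
have hF := flow_integrand_lipschitz hmu hm L0 W0 hS hL hW theta rho12 T1.
have hI := lipschitz_bochner_integrable T0 hF.
split=> //.
have hv : is_bochner_integral (@lebesgue_measure R) `[0, T]
    (flow_integrand w rho f T theta)
    (bochner_integral (@lebesgue_measure R) `[0, T]
      (flow_integrand w rho f T theta)) by exact: xgetPex.
have close := WB_flow_close hmu hgamma hm hw S0 M0 L0 W0 hS hM hL hW rho12
  hrho T1 hv.
apply: le_trans close _.
rewrite -/C2 ler_wpM2r ?invr_ge0 ?exprn_ge0 ?(ltW T0)//.
by rewrite -addrA addrCA lerDl addr_ge0.
Qed.
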